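(* Let $(T,\Phi)$ be a weighted triangulation of a closed connected surface $X$, with vertex set $V=\{v_1,\dots,v_N\}$. Given any initial circle-packing metric $(r_1(0),\dots,r_N(0))\in\mathbf{R}_{>0}^N$ based on $(T,\Phi)$ in Euclidean background geometry, the solution of the normalized combinatorial Ricci flow $$\frac{dr_i}{dt}=-(K_i-K_{av})\,r_i,\qquad i=1,\dots,N,$$ with this initial value exists for all time $t\ge 0$, and it converges if and only if for every nonempty proper subset $I\subset V$, $$\frac{2\pi |I|\,\chi(X)}{|V|}>-\sum_{(e,v)\in Lk(I)}(\pi-\Phi(e))+2\pi\chi(F_I).$$ Furthermore, if the solution converges, then it converges exponentially fast to the metric of constant curvature $2\pi\chi(X)/N$ (i.e. $K_i(\infty)=2\pi\chi(X)/N$ for all $i$).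
   Context: A weighted triangulation $(T,\Phi)$ of a closed surface $X$ is a triangulation $T$ with vertex set $V=\{v_1,\dots,v_N\}$, edge set $E$, triangle set $F$, together with a function (weight) $\Phi:E\to[0,\pi/2]$. Circle-packing metric (Euclidean background). A circle-packing metric based on $(T,\Phi)$ is a vector $r=(r_1,\dots,r_N)\in\mathbf{R}_{>0}^N$ ($r_i$ is assigned to $v_i$). The edge $e_{ij}$ joining $v_i$ and $v_j$ is given length $l_{ij}=\sqrt{r_i^2+r_j^2+2r_ir_j\cos\Phi(e_{ij})}$. Because $\Phi\le\pi/2$, the three lengths of each triangle satisfy the strict triangle inequalities, and each triangle of $T$ is realized as a Euclidean triangle with these lengths. Let $a_i$ be the sum of all inner angles at $v_i$ over the triangles at $v_i$; the curvature at $v_i$ is $K_i=2\pi-a_i$, and $K_{av}=\frac1N\sum_{i=1}^N K_i$ (which equals $2\pi\chi(X)/N$). Convergence. A solution $r(t)$, $t\ge 0$, is called convergent if $\lim_{t\to\infty}K_i(t)=K_i(\infty)\in(-\infty,2\pi)$ exists for all $i$ and $\lim_{t\to\infty}r_i(t)=r_i(\infty)\in\mathbf{R}_{>0}$ exists for all $i$. A convergent solution converges exponentially fast if there are positive constants $c_1,c_2$ such that $|K_i(t)-K_i(\infty)|\le c_1e^{-c_2t}$ and $|r_i(t)-r_i(\infty)|\le c_1e^{-c_2t}$ for all $t\ge0$ and all $i$. For $I\subset V$, $F_I$ is the subcomplex of $T$ consisting of all cells whose vertices are all in $I$, $\chi$ denotes Euler characteristic, and $Lk(I)$ is the set of pairs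 $(e,v)$ of an edge $e$ and a vertex $v$ such that the end points of $e$ are not in $I$, the vertex $v$ is in $I$, and $e$ and $v$ form a triangle of $T$. *)

(* Defs.v *)
From HB Require Import structures.
From mathcomp Require Import all_boot all_order all_algebra.
From mathcomp Require Import all_classical all_reals all_analysis.

Set Implicit Arguments.
Unset Strict Implicit.
Unset Printing Implicit Defensive.

Import Order.TTheory GRing.Theory Num.Theory.
Import numFieldNormedType.Exports.

Local Open Scope classical_set_scope.
Local Open Scope ring_scope.

Section Complexes.
Variable N : nat.
Implicit Types (T L : {set {set 'I_N}}) (I : {set 'I_N}).

(* Simplices are the nonempty vertex sets in T; every point of 'I_N is a
   vertex, so that N is the number of vertices. *)
Definition simplicial_complex T : Prop :=
  [/\ finset.set0 \notin T,
      forall i : 'I_N, [set i]%SET \in T &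
      forall s t : {set 'I_N},
        t \in T -> s \subset t -> s != finset.set0 -> s \in T].

Definition edges T : {set {set 'I_N}} := [set e in T | #|e| == 2]%SET.

Definition triangles T : {set {set 'I_N}} := [set t in T | #|t| == 3]%SET.

Definition vertex_link T (v : 'I_N) : {set {set 'I_N}} :=
  [set s in T | (v \notin s) && ((v |: s)%SET \in T)]%SET.

(* L is a simplicial circle: a closed polygon whose successive vertices are
   the (pairwise distinct) entries of c. *)
Definition simplicial_circle L : Prop :=
  exists c : seq 'I_N,
    [/\ uniq c, (2 < size c)%N &
        L = ([set [set x] | x in c] :|: [set [set x; next c x] | x in c])%SET].

(* The complex triangulates a closed surface iff all its vertex links are
   circles; this forces T to be purely 2-dimensional, with exactly two
   triangles at each edge. *)
Definition closed_surface_triangulation T : Prop :=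
  simplicial_complex T /\ forall v : 'I_N, simplicial_circle (vertex_link T v).

Definition connected_complex T : Prop :=
  (0 < N)%N /\ forall i j : 'I_N, connect [rel x y | [set x; y]%SET \in T] i j.

Definition euler_char T : int := \sum_(s in T) (-1) ^+ #|s|.-1.

Definition full_subcomplex T I : {set {set 'I_N}} :=
  [set s in T | s \subset I]%SET.

Definition Lk T I : {set {set 'I_N} * 'I_N} :=
  [set p : {set 'I_N} * 'I_N |
    [&& p.1 \in edges T, [disjoint p.1 & I], p.2 \in I &
        (p.2 |: p.1)%SET \in triangles T]]%SET.

End Complexes.

Section CirclePacking.
Variables (R : realType) (N : nat) (T : {set {set 'I_N}}).
(* Only the values of Phi on the edges of T are relevant. *)
Variable Phi : {set 'I_N} -> R.
Implicit Types (r : 'I_N -> R) (i j k : 'I_N).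

Definition is_weight : Prop :=
  forall e, e \in edges T -> 0 <= Phi e <= pi / 2.

Definition edge_length r i j : R :=
  Num.sqrt (r i ^+ 2 + r j ^+ 2 + 2 * r i * r j * cos (Phi [set i; j]%SET)).

(* The angle at i of the Euclidean triangle ijk, by the law of cosines. *)
Definition inner_angle r i j k : R :=
  acos ((edge_length r i j ^+ 2 + edge_length r i k ^+ 2
           - edge_length r j k ^+ 2)
        / (2 * edge_length r i j * edge_length r i k)).

(* The condition j < k makes each triangle ijk at i occur exactly once. *)
Definition angle_sum r i : R :=
  \sum_(j < N) \sum_(k < N | (j < k)%N && ([set i; j; k]%SET \in triangles T))
    inner_angle r i j k.

Definition curvature r i : R := 2 * pi - angle_sum r i.

Definition average_curvature r : R := (\sum_(i < N) curvature r i) / N%:R.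

(* f has derivative d at t relative to the time interval J, hence one-sided
   at an end point of J. *)
Definition has_derivative_in (J : set R) (f : R -> R) (t d : R) : Prop :=
  (f s - f t) / (s - t) @[s --> within J t^'] --> d.

Definition ricci_flow_solution (J : set R) (r0 : 'I_N -> R)
    (r : R -> 'I_N -> R) : Prop :=
  (forall i, r 0 i = r0 i) /\
  forall t, J t -> forall i,
    0 < r t i /\
    has_derivative_in J (fun s => r s i) t
      (- (curvature (r t) i - average_curvature (r t)) * r t i).

Definition converges_to (r : R -> 'I_N -> R) (Kinf rinf : 'I_N -> R) : Prop :=
  forall i, [/\ curvature (r t) i @[t --> +oo] --> Kinf i, Kinf i < 2 * pi,
                r t i @[t --> +oo] --> rinf i & 0 < rinf i].

Definition convergent (r : R -> 'I_N -> R) : Prop :=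
  exists Kinf rinf, converges_to r Kinf rinf.

Definition exponentially_fast (r : R -> 'I_N -> R) (Kinf rinf : 'I_N -> R) :
    Prop :=
  exists c1 c2 : R, [/\ 0 < c1, 0 < c2 & forall t, 0 <= t -> forall i,
    `|curvature (r t) i - Kinf i| <= c1 * expR (- c2 * t) /\
    `|r t i - rinf i| <= c1 * expR (- c2 * t)].

Definition combinatorial_condition : Prop :=
  forall I : {set 'I_N}, I != finset.set0 -> I \proper [set: 'I_N]%SET ->
    2 * pi * #|I|%:R * (euler_char T)%:~R / N%:R >
      - (\sum_(p in Lk T I) (pi - Phi p.1))
      + 2 * pi * (euler_char (full_subcomplex T I))%:~R.

End CirclePacking.

(* Main.v *)
Require Import Defs.
From HB Require Import structures.
From mathcomp Require Import all_boot all_order all_algebra.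
From mathcomp Require Import all_classical all_reals all_analysis.
From mathcomp Require Import ring lra.

Set Implicit Arguments.
Unset Strict Implicit.
Unset Printing Implicit Defensive.

Import Order.TTheory GRing.Theory Num.Theory.
Import numFieldNormedType.Exports.

Local Open Scope classical_set_scope.
Local Open Scope ring_scope.

(** Write u_i = ln r_i.  The flow becomes u' = - (K(u) - k) with
    k = 2 pi chi / N, because the average curvature is constant by
    Gauss-Bonnet.  Everything rests on the variation of the angles of one
    triangle: along a line in the u-space, the derivative of the angle at
    vertex 1 is w12 (x2 - x1) + w13 (x3 - x1), with weights that are
    symmetric, nonnegative because the cosines of the values of Phi
    lie in [0, 1], and bounded by an absolute constant ([is_derive_rangle],
    [edge_weight_ge0], [edge_weight_le]).  Hence K, as a function of u, is

    - globally Lipschitz and bounded, so Picard iteration gives a solution for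
      all times ([global_flow]);
    - monotone: the pairing of u - v with K(u) - K(v) is a sum of nonnegative
      quadratic forms over the triangles.  So the distance between two
      solutions does not increase, and solutions are unique
      ([log_flow_unique]);
    - strongly monotone on bounded sets, transversally to the constants
      ([lcurv_strongly_monotone]), because at most one of the three weights of
      a triangle degenerates and the 1-skeleton is connected.

    A bounded solution u(t) is compared with its own time shift u(t + h), which
    is another solution with the same sum of coordinates.  Strong monotonicity
    makes their distance decay exponentially, uniformly in h, so u(t) converges
    exponentially fast, and its limit has constant curvature
    ([log_flow_contract], [log_flow_limit]).

    It remains to see when u(t) is bounded.  If the solution converges, it is
    bounded, and the limit metric of constant curvature satisfies the
    inequalities of the theorem: for every metric the angles at the vertices
    of I are bounded by their values in the degenerate limit where the circles
    of I shrink to points, and summing these values over the triangles yields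
    Lk(I) and the Euler characteristic of F_I ([lim_angles_sum],
    [thurston_inequality]).  Conversely, suppose that the inequalities hold and
    that the spread of u is large.  Sort the coordinates of u and sum by parts:
    each large gap separates a set I of much smaller circles, whose angles are
    then close to their degenerate limits ([tri_pairing_ge_lim]), so that the
    total of K - k over I is negative by a definite amount, whereas small gaps
    contribute a bounded error ([gap_abel_bound]).  Therefore the pairing of u
    with K(u) - k is nonnegative when the spread is large
    ([lcurv_coercive]), |u|^2 cannot increase there, and u(t) stays bounded
    ([log_flow_bounded_of_condition]). *)

(** * Derivatives of real functions *)

Section RealDerivatives.
Variable R : realType.
Implicit Types (f g : R -> R) (s a b : R).

Lemma derD f g s a b : is_derive s 1 f a -> is_derive s 1 g b ->
  is_derive s 1 (fun t => f t + g t) (a + b).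
Proof. by move=> hf hg; exact: is_deriveD hf hg. Qed.

Lemma derB f g s a b : is_derive s 1 f a -> is_derive s 1 g b ->
  is_derive s 1 (fun t => f t - g t) (a - b).
Proof. by move=> hf hg; exact: is_deriveB hf hg. Qed.

Lemma derM f g s a b : is_derive s 1 f a -> is_derive s 1 g b ->
  is_derive s 1 (fun t => f t * g t) (a * g s + f s * b).
Proof.
move=> hf hg; have h : is_derive s 1 (fun t => f t * g t) (f s *: b + g s *: a).
  exact: is_deriveM hf hg.
by apply: (is_derive_eq h); rewrite /GRing.scale/=; ring.
Qed.

Lemma derC s a : is_derive s 1 (fun=> a) 0.
Proof. exact: is_derive_cst. Qed.

Lemma derZ f s a b : is_derive s 1 f a -> is_derive s 1 (fun t => b * f t) (b * a).
Proof. by move=> hf; apply: (is_derive_eq (derM (derC s b) hf)); rewrite mul0r add0r. Qed.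

Lemma derX2 f s a : is_derive s 1 f a ->
  is_derive s 1 (fun t => f t ^+ 2) (2 * f s * a).
Proof. by move=> hf; apply: (is_derive_eq (derM hf hf)); ring. Qed.

Lemma derV f s a : f s != 0 -> is_derive s 1 f a ->
  is_derive s 1 (fun t => (f t)^-1) (- a / f s ^+ 2).
Proof.
move=> f0 hf; apply: (is_derive_eq (is_deriveV f0 hf)).
by rewrite /GRing.scale/= mulrC mulrN mulNr.
Qed.

Lemma der_comp f g s a b : is_derive (g s) 1 f a -> is_derive s 1 g b ->
  is_derive s 1 (fun t => f (g t)) (a * b).
Proof. by move=> hf hg; exact: is_derive1_comp hf hg. Qed.

Lemma der_id s : is_derive s 1 (fun t : R => t) 1.
Proof. exact: is_derive_id. Qed.

Lemma der_sum (I : finType) (P : pred I) (F : I -> R -> R) (dF : I -> R) s :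
  (forall i, is_derive s 1 (F i) (dF i)) ->
  is_derive s 1 (fun t => \sum_(i | P i) F i t) (\sum_(i | P i) dF i).
Proof.
move=> h; have -> : (fun t => \sum_(i | P i) F i t) = \sum_(i | P i) F i.
  by apply/funext => t; rewrite fct_sumE.
by elim/big_ind2 : _ => // [|? ? ? ? ? ?]; [exact: is_derive_cst|exact: is_deriveD].
Qed.

Lemma der_continuous f s a : is_derive s 1 f a -> {for s, continuous f}.
Proof.
move=> h; apply: differentiable_continuous.
by apply/derivable1_diffP; case: h.
Qed.

Lemma mean_value (f df : R -> R) a b : a <= b ->
  (forall s, a <= s <= b -> is_derive s 1 f (df s)) ->
  exists2 c, a <= c <= b & f b - f a = df c * (b - a).
Proof.
move=> ab h; have [||c] := @MVT_segment _ f df a b ab; last by rewrite in_itv; exists c.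
  by move=> x /[!in_itv]/= /andP[? ?]; apply: h; rewrite !ltW.
apply: derivable_within_continuous => x; rewrite in_itv/= => /h.
by case.
Qed.

End RealDerivatives.

(** * Euclidean triangles in terms of squared side lengths *)

Section Triangle.
Variable R : realType.
Implicit Types a b c d A B C r x y z u v w e : R.

(** The squared distance of the centres of two circles of radii a and b whose
    intersection angle has cosine c. *)
Definition sqlen c a b := a ^+ 2 + b ^+ 2 + 2 * a * b * c.

(** The law of cosines, with the squares of the sides as variables. *)
Definition tri_cos A B C := (A + B - C) / (2 * Num.sqrt A * Num.sqrt B).

(** Sixteen times the squared area (Heron's formula). *)
Definition heron A B C := 4 * A * B - (A + B - C) ^+ 2.

Lemma sqlen_sym c a b : sqlen c a b = sqlen c b a.
Proof. by rewrite /sqlen; ring. Qed.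

Lemma heronC A B C : heron A B C = heron B A C.
Proof. by rewrite /heron; ring. Qed.

Lemma heronCA A B C : heron A B C = heron A C B.
Proof. by rewrite /heron; ring. Qed.

Lemma sqlen_gt0 c a b : 0 < a -> 0 < b -> 0 <= c -> 0 < sqlen c a b.
Proof.
move=> a0 b0 c0; rewrite /sqlen ltr_wpDr ?addr_gt0 ?exprn_gt0//.
by rewrite !mulr_ge0// ltW.
Qed.

Lemma tri_cos_sqr A B C : 0 < A -> 0 < B ->
  1 - tri_cos A B C ^+ 2 = heron A B C / (4 * A * B).
Proof.
move=> A0 B0; rewrite /tri_cos expr_div_n !exprMn !sqr_sqrtr ?ltW//.
by rewrite /heron; field; rewrite !gt_eqF.
Qed.

Lemma tri_cos_bound A B C : 0 < A -> 0 < B -> 0 < heron A B C ->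
  -1 < tri_cos A B C < 1.
Proof.
move=> A0 B0 S0.
rewrite -ltr_norml -(@ltr_pXn2r _ 2%N)// ?nnegrE// expr1n real_normK ?num_real//.
by rewrite -subr_gt0 tri_cos_sqr// divr_gt0// !mulr_gt0.
Qed.

Lemma sin_tri_angle A B C : 0 < A -> 0 < B -> 0 < heron A B C ->
  sin (acos (tri_cos A B C)) = Num.sqrt (heron A B C) / (2 * Num.sqrt A * Num.sqrt B).
Proof.
move=> A0 B0 S0; have /andP[X1 X2] := tri_cos_bound A0 B0 S0.
rewrite sin_acos ?ltW// tri_cos_sqr//.
have -> : 4 * A * B = (2 * Num.sqrt A * Num.sqrt B) ^+ 2.
  by rewrite !exprMn !sqr_sqrtr ?ltW//; ring.
rewrite sqrtrM ?ltW// sqrtrV ?exprn_ge0 ?mulr_ge0 ?sqrtr_ge0//.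
by rewrite sqrtr_sqr ger0_norm// !mulr_ge0 ?sqrtr_ge0.
Qed.

(** The angles are only known through acos, so the Euclidean angle sum has to
    be rederived from the addition formulas for the sum of two angles. *)
Lemma tri_angle_sum A B C : 0 < A -> 0 < B -> 0 < C -> 0 < heron A B C ->
  acos (tri_cos A B C) + acos (tri_cos A C B) + acos (tri_cos B C A) = pi.
Proof.
move=> A0 B0 C0 S0.
have S1 : heron A C B = heron A B C by rewrite heronCA.
have S2 : heron B C A = heron A B C by rewrite heronCA heronC.
have b1 := tri_cos_bound A0 B0 S0; have b1' := b1; move/andP: b1' => [b11 b12].
have b2 : -1 < tri_cos A C B < 1 by apply: tri_cos_bound => //; rewrite S1.
have b3 : -1 < tri_cos B C A < 1 by apply: tri_cos_bound => //; rewrite S2.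
have /andP[b21 b22] := b2; have /andP[b31 b32] := b3.
set x := acos (tri_cos A B C); set y := acos (tri_cos A C B).
set z := acos (tri_cos B C A).
have sx : sin x = Num.sqrt (heron A B C) / (2 * Num.sqrt A * Num.sqrt B).
  by rewrite /x sin_tri_angle.
have sy : sin y = Num.sqrt (heron A B C) / (2 * Num.sqrt A * Num.sqrt C).
  by rewrite /y sin_tri_angle ?S1.
have sz : sin z = Num.sqrt (heron A B C) / (2 * Num.sqrt B * Num.sqrt C).
  by rewrite /z sin_tri_angle ?S2.
have cx : cos x = tri_cos A B C by rewrite /x acosK// in_itv/= !ltW.
have cy : cos y = tri_cos A C B by rewrite /y acosK// in_itv/= !ltW.
have cz : cos z = tri_cos B C A by rewrite /z acosK// in_itv/= !ltW.
have [x0 xp] : 0 < x /\ x < pi.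
  by split; [apply: acos_gt0|apply: acos_ltpi]; rewrite ?b11 ?b12 !ltW.
have [y0 yp] : 0 < y /\ y < pi.
  by split; [apply: acos_gt0|apply: acos_ltpi]; rewrite ?b21 ?b22 !ltW.
have [z0 zp] : 0 < z /\ z < pi.
  by split; [apply: acos_gt0|apply: acos_ltpi]; rewrite ?b31 ?b32 !ltW.
have [sA sB sC] : [/\ 0 < Num.sqrt A, 0 < Num.sqrt B & 0 < Num.sqrt C].
  by rewrite !sqrtr_gt0.
have sS : Num.sqrt (heron A B C) ^+ 2 = heron A B C by rewrite sqr_sqrtr// ltW.
have [eA eB eC] : [/\ A = Num.sqrt A ^+ 2, B = Num.sqrt B ^+ 2 & C = Num.sqrt C ^+ 2].
  by rewrite !sqr_sqrtr ?ltW.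
have sxy : sin (x + y) = sin z.
  rewrite sinD sx sy sz cx cy /tri_cos.
  have -> : forall p : R,
     p / (2 * Num.sqrt A * Num.sqrt B) * ((A + C - B) / (2 * Num.sqrt A * Num.sqrt C)) +
     (A + B - C) / (2 * Num.sqrt A * Num.sqrt B) * (p / (2 * Num.sqrt A * Num.sqrt C))
     = p * (2 * A) / (4 * Num.sqrt A ^+ 2 * Num.sqrt B * Num.sqrt C).
     by move=> p; field; rewrite !gt_eqF.
  by rewrite -eA; field; rewrite !gt_eqF.
have cxy : cos (x + y) = - cos z.
  rewrite cosD sx sy cx cy cz /tri_cos.
  have -> : Num.sqrt (heron A B C) / (2 * Num.sqrt A * Num.sqrt B) *
     (Num.sqrt (heron A B C) / (2 * Num.sqrt A * Num.sqrt C)) =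
     heron A B C / (4 * Num.sqrt A ^+ 2 * Num.sqrt B * Num.sqrt C).
    by rewrite -[in RHS]sS; field; rewrite !gt_eqF.
  rewrite /heron.
  move: (Num.sqrt A) (Num.sqrt B) (Num.sqrt C) eA eB eC sA sB sC => p q s -> -> -> *.
  by field; rewrite !gt_eqF.
(* cos (x + y) = - cos z leaves x + y = pi + z open; the positive sine of x + y
   rules it out. *)
have xyp : x + y <= pi.
  rewrite leNgt; apply/negP => h.
  have : 0 < sin (x + y - pi).
    by apply: sin_gt0_pi; rewrite subr_gt0 h/=; move: xp yp; lra.
  have z1 : 0 < sin z by apply: sin_gt0_pi; rewrite z0 zp.
  by rewrite -[x + y - pi]opprK opprB sinN sinB sinpi cospi sxy; lra.
have : pi - z = x + y.
  apply: cos_inj.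
  - by rewrite in_itv/=; lra.
  - by rewrite in_itv/= xyp addr_ge0// ltW.
  by rewrite cxy addrC cosDpi cosN.
by lra.
Qed.

(** Differentiating the law of cosines: the square root of 1 - cos^2 is the
    square root of heron up to the factor 2 sqrt(A B), which cancels the
    denominator of tri_cos. *)
Lemma is_derive_acos_tri_cos (A B C : R -> R) (s dA dB dC : R) :
  0 < A s -> 0 < B s -> 0 < heron (A s) (B s) (C s) ->
  is_derive s 1 A dA -> is_derive s 1 B dB -> is_derive s 1 C dC ->
  is_derive s 1 (fun t => acos (tri_cos (A t) (B t) (C t)))
   ((dC - dA * (A s - B s + C s) / (2 * A s)
       - dB * (B s - A s + C s) / (2 * B s)) / Num.sqrt (heron (A s) (B s) (C s))).
Proof.
move=> A0 B0 S0 hA hB hC.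
have bX := tri_cos_bound A0 B0 S0.
have hac := is_derive1_acos bX.
have hsA := der_comp (is_derive1_sqrt A0) hA.
have hsB := der_comp (is_derive1_sqrt B0) hB.
have [sA sB sS] : [/\ 0 < Num.sqrt (A s), 0 < Num.sqrt (B s) &
   0 < Num.sqrt (heron (A s) (B s) (C s))] by rewrite !sqrtr_gt0.
have den0 : 2 * Num.sqrt (A s) * Num.sqrt (B s) != 0.
  by rewrite gt_eqF// !mulr_gt0.
have hinv := @derV _ (fun t => 2 * Num.sqrt (A t) * Num.sqrt (B t)) _ _ den0
  (derM (derZ 2 hsA) hsB).
have h := @der_comp _ (@acos R) (fun t => tri_cos (A t) (B t) (C t)) _ _ _ hac (derM (derB (derD hA hB) hC) hinv).
apply: (is_derive_eq h).
rewrite tri_cos_sqr//.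
have -> : Num.sqrt (heron (A s) (B s) (C s) / (4 * A s * B s)) =
    Num.sqrt (heron (A s) (B s) (C s)) / (2 * Num.sqrt (A s) * Num.sqrt (B s)).
  have -> : 4 * A s * B s = (2 * Num.sqrt (A s) * Num.sqrt (B s)) ^+ 2.
    by rewrite !exprMn !sqr_sqrtr ?ltW//; ring.
  rewrite sqrtrM ?ltW// sqrtrV ?exprn_ge0 ?mulr_ge0 ?sqrtr_ge0//.
  by rewrite sqrtr_sqr ger0_norm// !mulr_ge0 ?sqrtr_ge0.
rewrite /= /GRing.scale /=.
move: (Num.sqrt (heron _ _ _)) sS => S sS.
have eA : A s = Num.sqrt (A s) ^+ 2 by rewrite sqr_sqrtr ?ltW.
have eB : B s = Num.sqrt (B s) ^+ 2 by rewrite sqr_sqrtr ?ltW.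
move: eA eB sA sB.
move: (Num.sqrt (A s)) (Num.sqrt (B s)) => p q eA eB sA sB.
rewrite eA eB; field.
by rewrite !gt_eqF.
Qed.

End Triangle.

(** * Variation of the angles of a triangle of circles *)

(** Nonnegativity of expressions built from nonnegative atoms; factors
    1 - x ^+ 2 with 0 <= x <= 1 are recognized. *)
Ltac nneg := repeat first [done | by apply: ltW | rewrite subr_ge0 expr_le1//
  | apply: addr_ge0 | apply: mulr_ge0 | apply: exprn_ge0 | rewrite sqrtr_ge0//
  | rewrite invr_ge0//].

Section RadiusAngle.
Variable R : realType.

Definition edge_weight_num (c12 c13 c23 r1 r2 r3 : R) :=
  r1 * r2 * (1 - c12 ^+ 2) +
  r3 * (r2 * (c13 + c12 * c23) + r1 * (c23 + c12 * c13)).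

Definition rheron (c12 c13 c23 r1 r2 r3 : R) :=
  heron (sqlen c12 r1 r2) (sqlen c13 r1 r3) (sqlen c23 r2 r3).

(** The angle at the centre of the first circle; cij is the cosine of the
    intersection angle of the circles i and j. *)
Definition rangle (c12 c13 c23 r1 r2 r3 : R) :=
  acos (tri_cos (sqlen c12 r1 r2) (sqlen c13 r1 r3) (sqlen c23 r2 r3)).

(** The partial derivative of the angle at 1 with respect to ln r2.
    Geometrically it is the distance from the radical centre of the three
    circles to the edge 12, divided by the length of that edge. *)
Definition edge_weight (c12 c13 c23 r1 r2 r3 : R) :=
  2 * r1 * r2 * edge_weight_num c12 c13 c23 r1 r2 r3
    / (sqlen c12 r1 r2 * Num.sqrt (rheron c12 c13 c23 r1 r2 r3)).

Lemma rheron12 (c12 c13 c23 r1 r2 r3 : R) :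
  rheron c12 c13 c23 r1 r2 r3 = rheron c12 c23 c13 r2 r1 r3.
Proof. by rewrite /rheron /heron /sqlen; ring. Qed.

Lemma rheron23 (c12 c13 c23 r1 r2 r3 : R) :
  rheron c12 c13 c23 r1 r2 r3 = rheron c13 c12 c23 r1 r3 r2.
Proof. by rewrite /rheron /heron /sqlen; ring. Qed.

Lemma edge_weightC (c12 c13 c23 r1 r2 r3 : R) :
  edge_weight c12 c13 c23 r1 r2 r3 = edge_weight c12 c23 c13 r2 r1 r3.
Proof.
rewrite /edge_weight (sqlen_sym _ r1) rheron12; congr (_ / _).
by rewrite /edge_weight_num; ring.
Qed.

Section FixedTriangle.
Variables c12 c13 c23 : R.
Hypotheses (c12P : 0 <= c12 <= 1) (c13P : 0 <= c13 <= 1) (c23P : 0 <= c23 <= 1).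

(** This is where obtuse intersection angles are excluded: the weight is
    nonnegative because all the cosines are. *)
Lemma edge_weight_num_ge0 r1 r2 r3 : 0 < r1 -> 0 < r2 -> 0 < r3 ->
  0 <= edge_weight_num c12 c13 c23 r1 r2 r3.
Proof.
move: c12P c13P c23P => /andP[? ?] /andP[? ?] /andP[? ?] *.
rewrite /edge_weight_num; nneg.
Qed.
Let D r1 r2 := r1 ^+ 2 * (1 - c13 ^+ 2) + r2 ^+ 2 * (1 - c23 ^+ 2)
   + 2 * r1 * r2 * (c12 + c13 * c23).

(** What is dropped is a sum of products of nonnegative quantities.  The two
    remaining terms separate the part that is free of r3, which dominates when
    r3 is small, from the leading coefficient in r3. *)
Lemma rheron_ge r1 r2 r3 : 0 < r1 -> 0 < r2 -> 0 < r3 ->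
  4 * (r1 ^+ 2 * r2 ^+ 2 * (1 - c12 ^+ 2) + r3 ^+ 2 * D r1 r2)
   <= rheron c12 c13 c23 r1 r2 r3.
Proof.
move: c12P c13P c23P => /andP[? ?] /andP[? ?] /andP[? ?] r10 r20 r30.
have -> : rheron c12 c13 c23 r1 r2 r3 =
  4 * (r1 ^+ 2 * r2 ^+ 2 * (1 - c12 ^+ 2) + r3 ^+ 2 * D r1 r2)
  + 8 * r1 * r2 * r3 * (r1 * (c23 + c12 * c13) + r2 * (c13 + c12 * c23)).
  by rewrite /rheron /heron /sqlen /D; ring.
rewrite lerDl; nneg.
Qed.

(** If c12 = 0, the term that is free of r3 in [rheron_ge] is positive;
    otherwise the mixed term 2 r1 r2 c12 in the coefficient of r3^2 is. *)
Lemma rheron_gt0 r1 r2 r3 : 0 < r1 -> 0 < r2 -> 0 < r3 ->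
  0 < rheron c12 c13 c23 r1 r2 r3.
Proof.
move: c12P c13P c23P => /andP[? ?] /andP[? ?] /andP[? ?] r10 r20 r30.
apply: lt_le_trans (rheron_ge r10 r20 r30).
rewrite pmulr_rgt0// /D.
have h1 : 0 <= r1 ^+ 2 * (1 - c13 ^+ 2) + r2 ^+ 2 * (1 - c23 ^+ 2).
  by nneg.
have h2 : 0 <= r1 ^+ 2 * r2 ^+ 2 * (1 - c12 ^+ 2).
  by nneg.
have [c0|c0] := eqVneq c12 0.
  rewrite ltr_pwDl//; first by rewrite c0 expr0n/= subr0 mulr1 mulr_gt0 ?exprn_gt0.
  by nneg.
rewrite ltr_wpDl// mulr_gt0 ?exprn_gt0// ltr_wpDl// !mulr_gt0//.
by rewrite ltr_pwDl ?mulr_ge0// lt_neqAle eq_sym c0.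
Qed.

Lemma edge_weight_ge0 r1 r2 r3 : 0 < r1 -> 0 < r2 -> 0 < r3 ->
  0 <= edge_weight c12 c13 c23 r1 r2 r3.
Proof.
move=> r10 r20 r30; move/andP: (c12P) => [? _].
have := sqlen_gt0 r10 r20; rewrite /edge_weight => /(_ c12) A0.
have := edge_weight_num_ge0 r10 r20 r30 => W0.
by rewrite divr_ge0//; nneg; exact/ltW/A0.
Qed.

(** With A the squared length of the edge and S = rheron, the weight is
    2 r1 r2 (r1 r2 G + r3 Y) / (A sqrt S).  The first summand is controlled by
    the term of S that is free of r3, the second by the coefficient D of r3^2:
    A D >= (r1 r2)^2, so no smallness of D can make the quotient large. *)
Lemma edge_weight_le r1 r2 r3 : 0 < r1 -> 0 < r2 -> 0 < r3 ->
  edge_weight c12 c13 c23 r1 r2 r3 <= 5.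
Proof.
move: c12P c13P c23P => /andP[? ?] /andP[? ?] /andP[? ?] r10 r20 r30.
have A0 : 0 < sqlen c12 r1 r2 by rewrite sqlen_gt0.
have S0 := rheron_gt0 r10 r20 r30.
rewrite /edge_weight ler_pdivrMr ?mulr_gt0 ?sqrtr_gt0//.
rewrite mulrA.
set X := (X in X <= _).
have W0 := edge_weight_num_ge0 r10 r20 r30.
have X0 : 0 <= X by rewrite /X; nneg.
suff : X ^+ 2 <= (5 * sqlen c12 r1 r2) ^+ 2 * rheron c12 c13 c23 r1 r2 r3.
  move=> h; rewrite -(@ler_pXn2r _ 2%N)// ?nnegrE//.
    by rewrite [in leRHS]exprMn (sqr_sqrtr (ltW S0)).
  by nneg.
apply: le_trans (ler_wpM2l (sqr_ge0 _) (rheron_ge r10 r20 r30)).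
rewrite /X /edge_weight_num.
set A := sqlen c12 r1 r2.
set Y := r2 * (c13 + c12 * c23) + r1 * (c23 + c12 * c13).
set G := 1 - c12 ^+ 2.
have G0 : 0 <= G by rewrite subr_ge0 expr_le1.
have G1 : G <= 1 by rewrite gerBl sqr_ge0.
have AE : A = r1 ^+ 2 + r2 ^+ 2 + 2 * r1 * r2 * c12 by [].
have p12 : 0 < r1 * r2 by rewrite mulr_gt0.
have pc : 0 <= r1 * r2 * c12 by nneg.
have A1 : 2 * (r1 * r2) <= A.
  by have := sqr_ge0 (r1 - r2); rewrite AE; lra.
have A2 : r1 ^+ 2 + r2 ^+ 2 <= A by rewrite AE; lra.
have Y0 : 0 <= Y by rewrite /Y; nneg.
have Y1 : Y <= 2 * (r1 + r2).
  have hh : forall x y z : R, 0 <= x -> x <= 1 -> 0 <= y -> y <= 1 -> 0 <= z ->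
     z <= 1 -> x + y * z <= 2.
    move=> x y z *; have : y * z <= 1 * 1 by apply: ler_pM.
    by lra.
  have h1 : r2 * (c13 + c12 * c23) <= r2 * 2 by rewrite ler_wpM2l ?hh// ltW.
  have h2 : r1 * (c23 + c12 * c13) <= r1 * 2 by rewrite ler_wpM2l ?hh// ltW.
  by rewrite /Y; lra.
have Y2 : Y ^+ 2 <= 8 * A.
  have : Y ^+ 2 <= (2 * (r1 + r2)) ^+ 2 by rewrite ler_pXn2r ?nnegrE//; nneg.
  have := sqr_ge0 (r1 - r2); move: A2; lra.
(* In the lower bound obtained for A D, the coefficient of (r1 r2)^2 exceeds 1
   by 1 - (c13 - c23)^2 + 2 c13 c23, which is nonnegative. *)
have AD : (r1 * r2) ^+ 2 <= A * D r1 r2.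
  have s13 : 0 <= 1 - c13 ^+ 2 by rewrite subr_ge0 expr_le1.
  have s23 : 0 <= 1 - c23 ^+ 2 by rewrite subr_ge0 expr_le1.
  have c1323 : 0 <= c13 * c23 by rewrite mulr_ge0.
  have h1 : r1 ^+ 2 * (1 - c13 ^+ 2) + r2 ^+ 2 * (1 - c23 ^+ 2) +
      2 * r1 * r2 * (c13 * c23) <= D r1 r2.
    by rewrite /D lerD2l ler_wpM2l ?lerDr//; nneg.
  have D0' : 0 <= r1 ^+ 2 * (1 - c13 ^+ 2) + r2 ^+ 2 * (1 - c23 ^+ 2) +
      2 * r1 * r2 * (c13 * c23).
    by nneg.
  apply: le_trans (ler_pM (addr_ge0 (sqr_ge0 _) (sqr_ge0 _)) D0' A2 h1).
  have k1 : 0 <= r1 ^+ 4 * (1 - c13 ^+ 2) + r2 ^+ 4 * (1 - c23 ^+ 2).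
    by nneg.
  have k2 : 0 <= 2 * (r1 * r2) * (c13 * c23) * (r1 - r2) ^+ 2.
    by rewrite mulr_ge0 ?sqr_ge0//; nneg.
  have k3 : 0 <= (r1 * r2) ^+ 2 * (1 - (c13 - c23) ^+ 2 + 2 * (c13 * c23)).
    rewrite mulr_ge0 ?sqr_ge0// addr_ge0 ?mulr_ge0// subr_ge0.
    rewrite -real_normK ?num_real// expr_le1// ler_norml; lra.
  rewrite -subr_ge0.
  set Z := (Z in 0 <= Z).
  have -> : Z = (r1 ^+ 4 * (1 - c13 ^+ 2) + r2 ^+ 4 * (1 - c23 ^+ 2))
    + 2 * (r1 * r2) * (c13 * c23) * (r1 - r2) ^+ 2
    + (r1 * r2) ^+ 2 * (1 - (c13 - c23) ^+ 2 + 2 * (c13 * c23)).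
    by rewrite /Z; ring.
  exact: addr_ge0 (addr_ge0 k1 k2) k3.
have D0 : 0 <= D r1 r2.
  by rewrite /D; nneg.
have e1 : ((r1 * r2) * G) ^+ 2 <= A ^+ 2 * G.
  rewrite exprMn expr2 [in X in _ * X]expr2 mulrA ler_wpM2r//.
  rewrite -[leRHS]mulr1 ler_pM// ?sqr_ge0// -expr2 ler_pXn2r ?nnegrE ?ltW//.
  by move: A1 p12; lra.
have e2 : (r1 * r2) ^+ 2 * (r3 * Y) ^+ 2 <= 8 * (A ^+ 2 * (r3 ^+ 2 * D r1 r2)).
  have : (r1 * r2) ^+ 2 * Y ^+ 2 <= A * D r1 r2 * (8 * A).
    exact: ler_pM (sqr_ge0 _) (sqr_ge0 _) AD Y2.
  move/(ler_wpM2l (sqr_ge0 r3)); rewrite exprMn; lra.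
have e3 : (r1 * r2) ^+ 2 * ((r1 * r2) * G) ^+ 2 <= (r1 * r2) ^+ 2 * (A ^+ 2 * G).
  by rewrite ler_wpM2l// sqr_ge0.
(* This square gives (a + b)^2 <= 2 a^2 + 2 b^2 for the two summands. *)
have e4 := sqr_ge0 ((r1 * r2) * (r1 * r2 * G - r3 * Y)).
have e5 : 0 <= A ^+ 2 * (r3 ^+ 2 * D r1 r2).
  exact: mulr_ge0 (sqr_ge0 _) (mulr_ge0 (sqr_ge0 _) D0).
have e6 : 0 <= (r1 * r2) ^+ 2 * (A ^+ 2 * G).
  exact: mulr_ge0 (sqr_ge0 _) (mulr_ge0 (sqr_ge0 _) G0).
lra.
Qed.

End FixedTriangle.
End RadiusAngle.

Section AngleVariation.
Variable R : realType.
Variables c12 c13 c23 : R.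
Hypotheses (c12P : 0 <= c12 <= 1) (c13P : 0 <= c13 <= 1) (c23P : 0 <= c23 <= 1).

Lemma rangle_bounds r1 r2 r3 : 0 < r1 -> 0 < r2 -> 0 < r3 ->
  0 < rangle c12 c13 c23 r1 r2 r3 < pi.
Proof.
move=> r10 r20 r30.
move: c12P c13P => /andP[c120 _] /andP[c130 _].
have /andP[b1 b2] := tri_cos_bound (sqlen_gt0 r10 r20 c120) (sqlen_gt0 r10 r30 c130)
  (rheron_gt0 c12P c13P c23P r10 r20 r30).
by rewrite /rangle acos_gt0 ?acos_ltpi ?b1 ?b2 ?ltW.
Qed.

Lemma rangle_sum r1 r2 r3 : 0 < r1 -> 0 < r2 -> 0 < r3 ->
  rangle c12 c13 c23 r1 r2 r3 + rangle c12 c23 c13 r2 r1 r3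
    + rangle c13 c23 c12 r3 r1 r2 = pi.
Proof.
move=> r10 r20 r30.
move: c12P c13P c23P => /andP[c120 _] /andP[c130 _] /andP[c230 _].
have := tri_angle_sum (sqlen_gt0 r10 r20 c120) (sqlen_gt0 r10 r30 c130)
  (sqlen_gt0 r20 r30 c230) (rheron_gt0 c12P c13P c23P r10 r20 r30).
by rewrite /rangle (sqlen_sym c12 r2) (sqlen_sym c13 r3) (sqlen_sym c23 r3).
Qed.

Lemma is_derive_sqlen c (f g : R -> R) (s x y : R) :
  is_derive s 1 f (x * f s) -> is_derive s 1 g (y * g s) ->
  is_derive s 1 (fun t => sqlen c (f t) (g t))
    (2 * x * f s ^+ 2 + 2 * y * g s ^+ 2 + 2 * (x + y) * f s * g s * c).
Proof.
move=> hf hg.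
have h := derD (derD (derX2 hf) (derX2 hg)) (derM (derM (derZ 2 hf) hg) (derC s c)).
by apply: (is_derive_eq h); ring.
Qed.

(** Since the angle is invariant under scaling, its derivative depends only on
    the differences of the logarithmic velocities xi; the coefficients are
    found by clearing denominators. *)
Lemma is_derive_rangle (f1 f2 f3 : R -> R) (s x1 x2 x3 : R) :
  0 < f1 s -> 0 < f2 s -> 0 < f3 s ->
  is_derive s 1 f1 (x1 * f1 s) -> is_derive s 1 f2 (x2 * f2 s) ->
  is_derive s 1 f3 (x3 * f3 s) ->
  is_derive s 1 (fun t => rangle c12 c13 c23 (f1 t) (f2 t) (f3 t))
   (edge_weight c12 c13 c23 (f1 s) (f2 s) (f3 s) * (x2 - x1) +
    edge_weight c13 c12 c23 (f1 s) (f3 s) (f2 s) * (x3 - x1)).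
Proof.
move=> p1 p2 p3 h1 h2 h3.
move: c12P c13P c23P => /andP[c120 _] /andP[c130 _] /andP[c230 _].
have S0 := rheron_gt0 c12P c13P c23P p1 p2 p3.
have A0 := sqlen_gt0 p1 p2 c120; have B0 := sqlen_gt0 p1 p3 c130.
have h := @is_derive_acos_tri_cos _ (fun t => sqlen c12 (f1 t) (f2 t))
  (fun t => sqlen c13 (f1 t) (f3 t)) (fun t => sqlen c23 (f2 t) (f3 t)) _ _ _ _
  A0 B0 S0 (is_derive_sqlen c12 h1 h2)
  (is_derive_sqlen c13 h1 h3) (is_derive_sqlen c23 h2 h3).
apply: (is_derive_eq h).
rewrite /edge_weight -(rheron23 c12 c13) -/(rheron _ _ _ _ _ _).
have := S0; rewrite -sqrtr_gt0.
move: (Num.sqrt _) A0 B0 => S A0 B0 {}S0.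
rewrite /sqlen /edge_weight_num in A0 B0 *.
by field; rewrite !gt_eqF.
Qed.

(** Minus the derivative of x1 theta1 + x2 theta2 + x3 theta3 when ln r moves
    with velocity x: the quadratic form of the symmetric matrix of partial
    derivatives, whose rows sum to zero. *)
Definition dirichlet (r1 r2 r3 x1 x2 x3 : R) :=
  edge_weight c12 c13 c23 r1 r2 r3 * (x1 - x2) ^+ 2
  + edge_weight c13 c12 c23 r1 r3 r2 * (x1 - x3) ^+ 2
  + edge_weight c23 c12 c13 r2 r3 r1 * (x2 - x3) ^+ 2.

Lemma dirichlet_ge0 r1 r2 r3 x1 x2 x3 : 0 < r1 -> 0 < r2 -> 0 < r3 ->
  0 <= dirichlet r1 r2 r3 x1 x2 x3.
Proof.
by move=> *; rewrite /dirichlet !addr_ge0// mulr_ge0 ?sqr_ge0// edge_weight_ge0.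
Qed.

(** The radii range over a compact set, where the denominator is bounded and
    the numerator is bounded below by its value with all radii equal to p. *)
Lemma edge_weight_ge (p r1 r2 r3 : R) : 0 < p <= 1 -> p <= r1 <= p^-1 ->
  p <= r2 <= p^-1 -> p <= r3 <= p^-1 ->
  p ^+ 8 / 16 * (1 - c12 ^+ 2 + (c13 + c12 * c23) + (c23 + c12 * c13))
   <= edge_weight c12 c13 c23 r1 r2 r3.
Proof.
move=> /andP[p0 p1] /andP[r1l r1u] /andP[r2l r2u] /andP[r3l r3u].
have [r10 r20 r30] : [/\ 0 < r1, 0 < r2 & 0 < r3] by split; apply: lt_le_trans p0 _.
move: (c12P) (c13P) (c23P) => /andP[c120 c121] /andP[c130 c131] /andP[c230 c231].
have A0 := sqlen_gt0 r10 r20 c120; have B0 := sqlen_gt0 r10 r30 c130.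
have S0 := rheron_gt0 c12P c13P c23P r10 r20 r30.
set P := p^-1 in r1u r2u r3u *.
have P0 : 0 < P by rewrite invr_gt0.
have qle c a b : 0 <= c -> c <= 1 -> 0 < a -> 0 < b -> a <= P -> b <= P ->
    sqlen c a b <= 4 * P ^+ 2.
  move=> c0 c1 a0 b0 aP bP.
  have h1 : a * a <= P * P by apply: ler_pM; nneg.
  have h2 : b * b <= P * P by apply: ler_pM; nneg.
  have h3 : a * b * c <= P * P * 1 by apply: ler_pM; nneg; apply: ler_pM; nneg.
  by rewrite /sqlen; lra.
have A1 := qle _ _ _ c120 c121 r10 r20 r1u r2u.
have B1 := qle _ _ _ c130 c131 r10 r30 r1u r3u.
have S1 : Num.sqrt (rheron c12 c13 c23 r1 r2 r3) <= 8 * P ^+ 2.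
  have -> : 8 * P ^+ 2 = Num.sqrt ((8 * P ^+ 2) ^+ 2).
    by rewrite sqrtr_sqr ger0_norm//; nneg.
  rewrite ler_wsqrtr// /rheron /heron.
  have : sqlen c12 r1 r2 * sqlen c13 r1 r3 <= (4 * P ^+ 2) * (4 * P ^+ 2).
    by apply: ler_pM; nneg.
  by have := sqr_ge0 (sqlen c12 r1 r2 + sqlen c13 r1 r3 - sqlen c23 r2 r3); lra.
rewrite /edge_weight.
set s := edge_weight_num _ _ _ _ _ _.
set T := 1 - c12 ^+ 2 + _ + _.
have sT : p ^+ 2 * T <= s.
  rewrite /s /edge_weight_num /T.
  have g0 : 0 <= 1 - c12 ^+ 2 by nneg.
  have g1 : 0 <= c13 + c12 * c23 by nneg.
  have g2 : 0 <= c23 + c12 * c13 by nneg.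
  have h1 : p * p * (1 - c12 ^+ 2) <= r1 * r2 * (1 - c12 ^+ 2).
    by rewrite ler_wpM2r// ler_pM// ltW.
  have h2 : p * p * (c13 + c12 * c23) <= r3 * r2 * (c13 + c12 * c23).
    by rewrite ler_wpM2r// ler_pM// ltW.
  have h3 : p * p * (c23 + c12 * c13) <= r3 * r1 * (c23 + c12 * c13).
    by rewrite ler_wpM2r// ler_pM// ltW.
  by lra.
have T0 : 0 <= T by rewrite /T; do 2![apply: addr_ge0]; nneg.
rewrite ler_pdivlMr ?mulr_gt0 ?sqrtr_gt0//.
have h1 : sqlen c12 r1 r2 * Num.sqrt (rheron c12 c13 c23 r1 r2 r3)
   <= (4 * P ^+ 2) * (8 * P ^+ 2) by apply: ler_pM; nneg.
have pT : 0 <= p ^+ 8 / 16 * T by nneg.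
apply: le_trans (ler_wpM2l pT h1) _.
have -> : p ^+ 8 / 16 * T * (4 * P ^+ 2 * (8 * P ^+ 2)) = 2 * (p * p) * (p ^+ 2 * T).
  by rewrite /P; field; rewrite gt_eqF.
apply: ler_pM => //; nneg.
by rewrite -mulrA ler_pM2l// ler_pM// ltW.
Qed.

End AngleVariation.

Section LogRadii.
Variable R : realType.
Variables c12 c13 c23 : R.
Hypotheses (c12P : 0 <= c12 <= 1) (c13P : 0 <= c13 <= 1) (c23P : 0 <= c23 <= 1).

Definition expline (v x t : R) := expR (v + t * x).

Lemma expline_gt0 (v x t : R) : 0 < expline v x t.
Proof. exact: expR_gt0. Qed.

Lemma is_derive_expline (v x s : R) :
  is_derive s 1 (expline v x) (x * expline v x s).
Proof.
have hl := derD (derC s v) (derM (der_id s) (derC s x)).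
have h := @der_comp _ expR (fun t => v + t * x) s _ _ (is_derive_expR _) hl.
by apply: (is_derive_eq h); rewrite /expline; ring.
Qed.

(** Each of the two weights in the derivative is at most 5. *)
Lemma rangle_lipschitz (u1 u2 u3 v1 v2 v3 : R) :
  `|rangle c12 c13 c23 (expR u1) (expR u2) (expR u3)
    - rangle c12 c13 c23 (expR v1) (expR v2) (expR v3)|
  <= 10 * (`|u1 - v1| + `|u2 - v2| + `|u3 - v3|).
Proof.
have [] := mean_value ler01
   (fun s _ => is_derive_rangle c12P c13P c23P
     (expline_gt0 v1 (u1 - v1) s) (expline_gt0 v2 (u2 - v2) s) (expline_gt0 v3 (u3 - v3) s)
     (is_derive_expline v1 _ s) (is_derive_expline v2 _ s) (is_derive_expline v3 _ s)).
move=> s _; rewrite /expline !mul1r !mul0r !addr0 subr0 mulr1 ![_ + (_ - _)]addrC !subrK => ->.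
set w12 := edge_weight _ _ _ _ _ _; set w13 := edge_weight _ _ _ _ _ _.
have : `|w12| <= 5 by rewrite ger0_norm ?edge_weight_le ?edge_weight_ge0 ?expR_gt0.
have : `|w13| <= 5 by rewrite ger0_norm ?edge_weight_le ?edge_weight_ge0 ?expR_gt0.
move=> k13 k12; apply: le_trans (ler_normD _ _) _; rewrite (normrM w12) (normrM w13).
have n2 : `|u2 - v2 - (u1 - v1)| <= `|u2 - v2| + `|u1 - v1| by apply: ler_normB.
have n3 : `|u3 - v3 - (u1 - v1)| <= `|u3 - v3| + `|u1 - v1| by apply: ler_normB.
have := ler_pM (normr_ge0 _) (normr_ge0 _) k12 n2.
have := ler_pM (normr_ge0 _) (normr_ge0 _) k13 n3.
have := normr_ge0 (u2 - v2); have := normr_ge0 (u3 - v3); lra.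
Qed.

(** The mean value theorem along the segment from v to u; the symmetry of the
    weights turns the six terms of the derivative into squares. *)
Lemma rangle_pairing_mean_value (u1 u2 u3 v1 v2 v3 : R) :
  exists2 s, 0 <= s <= 1 &
  let T c c' c'' a b d := rangle c c' c'' (expR a) (expR b) (expR d) in
  (u1 - v1) * (T c12 c13 c23 u1 u2 u3 - T c12 c13 c23 v1 v2 v3)
  + (u2 - v2) * (T c12 c23 c13 u2 u1 u3 - T c12 c23 c13 v2 v1 v3)
  + (u3 - v3) * (T c13 c23 c12 u3 u1 u2 - T c13 c23 c12 v3 v1 v2)
  = - dirichlet c12 c13 c23 (expR (v1 + s * (u1 - v1))) (expR (v2 + s * (u2 - v2)))
      (expR (v3 + s * (u3 - v3))) (u1 - v1) (u2 - v2) (u3 - v3).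
Proof.
set x1 := u1 - v1; set x2 := u2 - v2; set x3 := u3 - v3.
pose e := expline.
pose f t := x1 * rangle c12 c13 c23 (e v1 x1 t) (e v2 x2 t) (e v3 x3 t)
  + x2 * rangle c12 c23 c13 (e v2 x2 t) (e v1 x1 t) (e v3 x3 t)
  + x3 * rangle c13 c23 c12 (e v3 x3 t) (e v1 x1 t) (e v2 x2 t).
have df (s : R) : is_derive s 1 f (- dirichlet c12 c13 c23 (e v1 x1 s) (e v2 x2 s)
      (e v3 x3 s) x1 x2 x3).
  have d1 := is_derive_expline v1 x1 s; have d2 := is_derive_expline v2 x2 s.
  have d3 := is_derive_expline v3 x3 s.
  have h1 := is_derive_rangle c12P c13P c23P (expline_gt0 _ _ _) (expline_gt0 _ _ _) (expline_gt0 _ _ _)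
    d1 d2 d3.
  have h2 := is_derive_rangle c12P c23P c13P (expline_gt0 _ _ _) (expline_gt0 _ _ _) (expline_gt0 _ _ _)
    d2 d1 d3.
  have h3 := is_derive_rangle c13P c23P c12P (expline_gt0 _ _ _) (expline_gt0 _ _ _) (expline_gt0 _ _ _)
    d3 d1 d2.
  apply: (is_derive_eq (derD (derD (derZ x1 h1) (derZ x2 h2)) (derZ x3 h3))).
  rewrite /dirichlet /e.
  rewrite (edge_weightC c12 c23 c13) (edge_weightC c13 c23 c12) (edge_weightC c23 c13 c12).
  ring.
have [s s01 E] := mean_value ler01 (fun s _ => df s).
exists s => //; move: E.
rewrite /f /e /expline !mul1r !mul0r !addr0 subr0 mulr1.
have -> : v1 + x1 = u1 by rewrite /x1; ring.
have -> : v2 + x2 = u2 by rewrite /x2; ring.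
have -> : v3 + x3 = u3 by rewrite /x3; ring.
move=> <-; rewrite /=; ring.
Qed.

(** A single weight may vanish: w12 does when circles 1 and 2 are tangent and
    both orthogonal to circle 3.  But with p12, p13, p23 the cosine factors of
    the lower bounds of the weights, any two of them sum to at least 2, hence
    at least two are at least 1, and two squared differences control the
    third. *)
Lemma dirichlet_ge (p r1 r2 r3 x1 x2 x3 : R) : 0 < p <= 1 -> p <= r1 <= p^-1 ->
  p <= r2 <= p^-1 -> p <= r3 <= p^-1 ->
  p ^+ 8 / 48 * ((x1 - x2) ^+ 2 + (x1 - x3) ^+ 2 + (x2 - x3) ^+ 2)
   <= dirichlet c12 c13 c23 r1 r2 r3 x1 x2 x3.
Proof.
move=> hp h1 h2 h3.
have := edge_weight_ge c12P c13P c23P hp h1 h2 h3.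
have := edge_weight_ge c13P c12P c23P hp h1 h3 h2.
have := edge_weight_ge c23P c12P c13P hp h2 h3 h1.
rewrite /dirichlet; set w23 := edge_weight c23 _ _ _ _ _.
set w13 := edge_weight c13 _ _ _ _ _; set w12 := edge_weight c12 _ _ _ _ _.
have p0 : 0 <= p ^+ 8 / 16 by move/andP: hp => [? _]; nneg.
set m := p ^+ 8 / 16 in p0 *.
move: (c12P) (c13P) (c23P) => /andP[c120 c121] /andP[c130 c131] /andP[c230 c231].
set p23 := (X in m * X <= w23 -> _); set p13 := (X in _ -> m * X <= w13 -> _).
set p12 := (X in _ -> _ -> m * X <= w12 -> _) => k23 k13 k12.
have q12 : 0 <= c12 - c12 ^+ 2 by rewrite expr2 -{1}[c12]mulr1 -mulrBr mulr_ge0// subr_ge0.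
have q13 : 0 <= c13 - c13 ^+ 2 by rewrite expr2 -{1}[c13]mulr1 -mulrBr mulr_ge0// subr_ge0.
have q23 : 0 <= c23 - c23 ^+ 2 by rewrite expr2 -{1}[c23]mulr1 -mulrBr mulr_ge0// subr_ge0.
have t1 : 0 <= c12 * c13 by nneg.
have t2 : 0 <= c12 * c23 by nneg.
have t3 : 0 <= c13 * c23 by nneg.
have s1 : 2 <= p12 + p13 by rewrite /p12 /p13; lra.
have s2 : 2 <= p12 + p23 by rewrite /p12 /p23; lra.
have s3 : 2 <= p13 + p23 by rewrite /p13 /p23; lra.
have n12 : 0 <= p12 by rewrite /p12; lra.
have n13 : 0 <= p13 by rewrite /p13; lra.
have n23 : 0 <= p23 by rewrite /p23; lra.
(* The cosine factors p12, p13, p23 suffice; the radii only enter through m. *)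
suff key : 3^-1 * ((x1 - x2) ^+ 2 + (x1 - x3) ^+ 2 + (x2 - x3) ^+ 2) <=
   p12 * (x1 - x2) ^+ 2 + p13 * (x1 - x3) ^+ 2 + p23 * (x2 - x3) ^+ 2.
  have := ler_wpM2l p0 key.
  have := ler_wpM2r (sqr_ge0 (x1 - x2)) k12.
  have := ler_wpM2r (sqr_ge0 (x1 - x3)) k13.
  have := ler_wpM2r (sqr_ge0 (x2 - x3)) k23.
  have -> : p ^+ 8 / 48 = m / 3 by rewrite /m; field.
  by lra.
have a12 := sqr_ge0 (x1 - x2); have a13 := sqr_ge0 (x1 - x3); have a23 := sqr_ge0 (x2 - x3).
have f12 q : 1 <= q -> (x1 - x2) ^+ 2 <= q * (x1 - x2) ^+ 2 by move=> *; rewrite ler_peMl.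
have f13 q : 1 <= q -> (x1 - x3) ^+ 2 <= q * (x1 - x3) ^+ 2 by move=> *; rewrite ler_peMl.
have f23 q : 1 <= q -> (x2 - x3) ^+ 2 <= q * (x2 - x3) ^+ 2 by move=> *; rewrite ler_peMl.
have g12 := mulr_ge0 n12 a12; have g13 := mulr_ge0 n13 a13; have g23 := mulr_ge0 n23 a23.
have b1 := sqr_ge0 (x1 - x2 + (x1 - x3)).
have b2 := sqr_ge0 (x2 - x1 + (x2 - x3)).
have b3 := sqr_ge0 (x3 - x1 + (x3 - x2)).
have [l12|l12] := leP 1 p12.
  have [l13|l13] := leP 1 p13.
    by have := f12 _ l12; have := f13 _ l13; lra.
  have l23 : 1 <= p23 by lra.
  by have := f12 _ l12; have := f23 _ l23; lra.
have l13 : 1 <= p13 by lra.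
have l23 : 1 <= p23 by lra.
by have := f13 _ l13; have := f23 _ l23; lra.
Qed.

End LogRadii.

(** * Angles of degenerating triangles *)

Section AngleAsymptotics.
Variable R : realType.
Variables c12 c13 : R.
Variable phi : R.
Let c23 := cos phi.
Hypotheses (c12P : 0 <= c12 <= 1) (c13P : 0 <= c13 <= 1) (phiP : 0 <= phi <= pi / 2).

Lemma cos_weight : 0 <= cos phi <= 1.
Proof.
move/andP: phiP => [p0 p1]; rewrite cos_le1 cos_ge0_pihalf//.
by rewrite p1 andbT (le_trans _ p0)// oppr_le0 divr_ge0// pi_ge0.
Qed.

Lemma cos_rangle r1 r2 r3 : 0 < r1 -> 0 < r2 -> 0 < r3 ->
  cos (rangle c12 c13 c23 r1 r2 r3) = tri_cos (sqlen c12 r1 r2) (sqlen c13 r1 r3)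
    (sqlen c23 r2 r3).
Proof.
move=> r10 r20 r30; move: c12P c13P => /andP[c120 _] /andP[c130 _].
have /andP[b1 b2] := tri_cos_bound (sqlen_gt0 r10 r20 c120) (sqlen_gt0 r10 r30 c130)
  (rheron_gt0 c12P c13P cos_weight r10 r20 r30).
by rewrite /rangle acosK// in_itv/= !ltW.
Qed.

Lemma tri_cos_sqlenE r1 r2 r3 : tri_cos (sqlen c12 r1 r2) (sqlen c13 r1 r3)
    (sqlen c23 r2 r3) =
  (r1 ^+ 2 + r1 * r2 * c12 + r1 * r3 * c13 - r2 * r3 * c23) /
  (Num.sqrt (sqlen c12 r1 r2) * Num.sqrt (sqlen c13 r1 r3)).
Proof.
rewrite /tri_cos -mulrA invfM mulrA; congr (_ / _).
by rewrite /sqlen; field.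
Qed.

Lemma sqrt_sqlen_gt (c a b : R) : 0 <= c -> 0 < a -> 0 < b -> b < Num.sqrt (sqlen c a b).
Proof.
move=> c0 a0 b0; have -> : b = Num.sqrt (b ^+ 2) by rewrite sqrtr_sqr ger0_norm// ltW.
rewrite [in ltRHS]sqrtr_sqr ger0_norm; last exact: ltW.
rewrite ltr_sqrt ?sqlen_gt0// /sqlen.
have : 0 < a ^+ 2 by rewrite exprn_gt0.
have : 0 <= a * b * c by nneg.
lra.
Qed.

Lemma sqrt_sqlen_le (c a b : R) : 0 <= c <= 1 -> 0 < a -> 0 < b -> Num.sqrt (sqlen c a b) <= a + b.
Proof.
move=> /andP[c0 c1] a0 b0.
have -> : a + b = Num.sqrt ((a + b) ^+ 2).
  by rewrite sqrtr_sqr ger0_norm//; nneg.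
rewrite ler_wsqrtr// /sqlen.
have : a * b * c <= a * b by rewrite ler_piMr//; nneg.
lra.
Qed.

(** Compare the law of cosines with - cos phi: the sides at vertex 1 are longer
    than r2 and r3, respectively. *)
Lemma rangle_lt r1 r2 r3 : 0 < r1 -> 0 < r2 -> 0 < r3 ->
  rangle c12 c13 c23 r1 r2 r3 < pi - phi.
Proof.
move=> r10 r20 r30; move/andP: phiP => [p0 p1].
have /andP[a0 ap] := rangle_bounds c12P c13P cos_weight r10 r20 r30.
move: (c12P) (c13P) (cos_weight) => /andP[c120 _] /andP[c130 _] /andP[c230 _].
have pp := pi_gt0 R.
rewrite -ltr_cos ?in_itv/=; [|lra|lra].
rewrite addrC cosDpi cosN cos_rangle// tri_cos_sqlenE.
have l2 := sqrt_sqlen_gt c120 r10 r20; have l3 := sqrt_sqlen_gt c130 r10 r30.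
move: (Num.sqrt _) l2 => L2 l2; move: (Num.sqrt _) l3 => L3 l3.
have LL : r2 * r3 < L2 * L3 by rewrite ltr_pM// ltW.
have LL0 : 0 < L2 * L3 by apply: le_lt_trans LL; nneg.
rewrite ltr_pdivlMr// mulNr.
have : r2 * r3 * c23 <= L2 * L3 * c23 by rewrite ler_wpM2r// ltW.
have : 0 < r1 ^+ 2 by rewrite exprn_gt0.
have : 0 <= r1 * r2 * c12 by nneg.
have : 0 <= r1 * r3 * c13 by nneg.
rewrite -/c23; lra.
Qed.

(** When r1 is negligible, the sides at vertex 1 are almost r2 and r3 and the
    law of cosines tends to - cos phi, whatever the ratio of r2 to r3.  The
    bound on q is uniform in phi because cos phi - cos (phi + e) is at least
    2 sin^2 (e/2) for phi in [0, pi/2]. *)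
Lemma rangle_ge (e q r1 r2 r3 : R) : 0 < e -> e <= pi / 2 -> 0 < q -> q <= 1 ->
  6 * q < 2 * sin (e / 2) ^+ 2 ->
  0 < r1 -> 0 < r2 -> 0 < r3 -> r1 <= q * r2 -> r1 <= q * r3 ->
  pi - phi - e <= rangle c12 c13 c23 r1 r2 r3.
Proof.
move=> e0 e1 q0 q1 qe r10 r20 r30 r12 r13; move/andP: phiP => [p0 p1].
have /andP[a0 ap] := rangle_bounds c12P c13P cos_weight r10 r20 r30.
move: (c12P) (c13P) (cos_weight) => /andP[c120 c121] /andP[c130 c131] /andP[c230 c231].
have pp := pi_gt0 R.
have cE : cos phi - cos (phi + e) = 2 * sin (phi + e / 2) * sin (e / 2).
  have -> : cos phi = cos ((phi + e / 2) - e / 2) by congr cos; lra.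
  have -> : cos (phi + e) = cos ((phi + e / 2) + e / 2) by congr cos; lra.
  by rewrite cosB (cosD (phi + e / 2)); ring.
have se0 : 0 < sin (e / 2) by apply: sin_gt0_pi; lra.
(* The argument phi + e / 2 may exceed pi / 2, where sin decreases. *)
have ss : sin (e / 2) <= sin (phi + e / 2).
  have E : sin (phi + e / 2) - sin (e / 2) = 2 * cos ((phi + e) / 2) * sin (phi / 2).
    have -> : sin (phi + e / 2) = sin ((phi + e) / 2 + phi / 2) by congr sin; lra.
    have -> : sin (e / 2) = sin ((phi + e) / 2 - phi / 2) by congr sin; lra.
    by rewrite sinB (sinD ((phi + e) / 2)); ring.
  rewrite -subr_ge0 E !mulr_ge0//.
    by apply: cos_ge0_pihalf; lra.
  by apply: sin_ge0_pi; lra.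
have cD : 6 * q < cos phi - cos (phi + e).
  rewrite cE; apply: lt_le_trans qe _.
  by rewrite expr2 mulrA (ler_wpM2r (ltW se0))// ler_pM2l.
rewrite leNgt; apply/negP => lt.
have : cos (pi - phi - e) < cos (rangle c12 c13 c23 r1 r2 r3).
  by rewrite ltr_cos ?in_itv//=; lra.
rewrite -addrA -opprD addrC cosDpi cosN cos_rangle// tri_cos_sqlenE.
have l2 := sqrt_sqlen_gt c120 r10 r20; have l3 := sqrt_sqlen_gt c130 r10 r30.
have m2 := sqrt_sqlen_le c12P r10 r20; have m3 := sqrt_sqlen_le c13P r10 r30.
move: (Num.sqrt _) l2 m2 => L2 l2 m2; move: (Num.sqrt _) l3 m3 => L3 l3 m3.
have LL : r2 * r3 < L2 * L3 by rewrite ltr_pM// ltW.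
have LL0 : 0 < L2 * L3 by apply: le_lt_trans LL; nneg.
rewrite ltr_pdivlMr//.
have MM : L2 * L3 <= (1 + q) ^+ 2 * (r2 * r3).
  have : L2 * L3 <= ((1 + q) * r2) * ((1 + q) * r3) by apply: ler_pM; lra.
  lra.
have rr0 : 0 < r2 * r3 by rewrite mulr_gt0.
have k1 : r1 * r2 * c12 <= q * (r2 * r3).
  have : r1 * r2 * c12 <= (q * r3) * r2 * 1 by apply: ler_pM; nneg; apply: ler_pM; nneg.
  lra.
have k2 : r1 * r3 * c13 <= q * (r2 * r3).
  have : r1 * r3 * c13 <= (q * r2) * r3 * 1 by apply: ler_pM; nneg; apply: ler_pM; nneg.
  lra.
have k3 : r1 ^+ 2 <= q * (r2 * r3).
  have : r1 * r1 <= (q * r2) * (q * r3) by apply: ler_pM => //; nneg.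
  have : q * (q * (r2 * r3)) <= 1 * (q * (r2 * r3)) by rewrite ler_wpM2r//; nneg.
  lra.
have qq : q ^+ 2 <= q by rewrite expr2 ler_piMl// ltW.
have k4 : (L2 * L3) * c23 <= r2 * r3 * (c23 + 3 * q).
  have h1 : (L2 * L3) * c23 <= (1 + q) ^+ 2 * (r2 * r3) * c23 by rewrite ler_wpM2r.
  have : (r2 * r3) * (((1 + q) ^+ 2 - 1) * c23) <= (r2 * r3) * ((3 * q) * 1).
    rewrite ler_pM2l//; apply: ler_pM => //; nra.
  lra.
have : 6 * q * (r2 * r3) <= 6 * q * (L2 * L3) by rewrite ler_wpM2l//; nneg.
have : 6 * q * (L2 * L3) < (cos phi - cos (phi + e)) * (L2 * L3) by rewrite ltr_pM2r.
rewrite -/c23; lra.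
Qed.
End AngleAsymptotics.

Section AngleAtLargeCircle.
Variable R : realType.
Variables c12 c13 : R.
Variable phi : R.
Hypotheses (c12P : 0 <= c12 <= 1) (c13P : 0 <= c13 <= 1) (phiP : 0 <= phi <= pi / 2).

(** When r2 and r3 are negligible, the law of cosines tends to 1.  The condition
    on q is the one of [rangle_ge], so that both can be used together. *)
Lemma rangle_le (e q r1 r2 r3 : R) : 0 < e -> e <= pi / 2 -> 0 < q -> q <= 1 ->
  6 * q < 2 * sin (e / 2) ^+ 2 ->
  0 < r1 -> 0 < r2 -> 0 < r3 -> r2 <= q * r1 -> r3 <= q * r1 ->
  rangle c12 c13 (cos phi) r1 r2 r3 <= e.
Proof.
move=> e0 e1 q0 q1 qe r10 r20 r30 r21 r31.
have c23P := cos_weight phiP.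
have /andP[a0 ap] := rangle_bounds c12P c13P c23P r10 r20 r30.
move: (c12P) (c13P) (c23P) => /andP[c120 c121] /andP[c130 c131] /andP[c230 c231].
have pp := pi_gt0 R.
have cE : cos e = 1 - 2 * sin (e / 2) ^+ 2.
  have -> : cos e = cos (e / 2 + e / 2) by congr cos; lra.
  by rewrite cosD -!expr2 cos2sin2; ring.
rewrite leNgt; apply/negP => lt.
have : cos (rangle c12 c13 (cos phi) r1 r2 r3) < cos e.
  by rewrite ltr_cos ?in_itv//=; lra.
rewrite cos_rangle// tri_cos_sqlenE.
have l2 := sqrt_sqlen_gt c120 r10 r20; have l3 := sqrt_sqlen_gt c130 r10 r30.
have m2 := sqrt_sqlen_le c12P r10 r20; have m3 := sqrt_sqlen_le c13P r10 r30.
move: (Num.sqrt _) l2 m2 => L2 l2 m2; move: (Num.sqrt _) l3 m3 => L3 l3 m3.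
have LL0 : 0 < L2 * L3.
  by apply: le_lt_trans (_ : r2 * r3 < _); [nneg|rewrite ltr_pM// ltW].
rewrite ltr_pdivrMr//.
have MM : L2 * L3 <= (1 + q) ^+ 2 * r1 ^+ 2.
  have : L2 * L3 <= ((1 + q) * r1) * ((1 + q) * r1) by apply: ler_pM; lra.
  lra.
have k1 : r2 * r3 * cos phi <= q * r1 * (q * r1) * 1.
  by apply: ler_pM; nneg; apply: ler_pM; nneg.
have k2 : 0 <= r1 * r2 * c12 by nneg.
have k3 : 0 <= r1 * r3 * c13 by nneg.
have k4 : 6 * q * (L2 * L3) < 2 * sin (e / 2) ^+ 2 * (L2 * L3) by rewrite ltr_pM2r.
have s0 : 0 < r1 ^+ 2 by rewrite exprn_gt0.
have qq : q ^+ 2 <= q by rewrite expr2 ler_piMl// ltW.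
have qr : q ^+ 2 * r1 ^+ 2 <= q * r1 ^+ 2 by rewrite ler_pM2r.
have k5 : (1 - 6 * q) * (L2 * L3) <= (1 - q) * r1 ^+ 2.
  have [q6|q6] := leP (1 - 6 * q) 0.
    apply: (@le_trans _ _ 0); first by rewrite mulr_le0_ge0// ltW.
    by rewrite mulr_ge0 ?subr_ge0// ltW.
  have : (1 - 6 * q) * (L2 * L3) <= (1 - 6 * q) * ((1 + q) ^+ 2 * r1 ^+ 2).
    by rewrite ler_pM2l.
  have : (1 - 6 * q) * (1 + q) ^+ 2 * r1 ^+ 2 <= (1 - q) * r1 ^+ 2.
    rewrite ler_pM2r//.
    have : 0 <= q ^+ 3 by nneg.
    have : 0 <= q ^+ 2 by nneg.
    by lra.
  by lra.
by rewrite cE; lra.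
Qed.
End AngleAtLargeCircle.

(** * Sums over ordered pairs and triples *)

Section Counting.
Variables (I : finType) (V : zmodType).

Lemma sum_ordered_pairs (f : {set I} -> V) :
  \sum_i \sum_(j | j != i) f [set i; j]%SET = (\sum_(e : {set I} | #|e| == 2) f e) *+ 2.
Proof.
rewrite pair_big_dep/= -sumrMnl.
rewrite (partition_big (fun p : I * I => [set p.1; p.2]%SET)
   (fun e : {set I} => #|e| == 2)); last first.
  by move=> p pn; rewrite cards2 (eq_sym p.1) pn.
apply: eq_bigr => e /cards2P[a [b [ab ->]]].
rewrite (eq_bigr (fun=> f [set a; b]%SET)); last by move=> p /andP[_ /eqP->].
rewrite sumr_const; congr (_ *+ _).
transitivity #|[set (a, b); (b, a)]%SET|; last by rewrite cards2 xpair_eqE negb_and ab.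
apply: eq_card => -[x y]; rewrite !inE/= !xpair_eqE.
apply/andP/orP => [[yx /eqP E]|[/andP[/eqP-> /eqP->]|/andP[/eqP-> /eqP->]]]; last 2 first.
- by rewrite eq_sym ab.
- by rewrite ab finset.setUC.
have : x \in [set a; b]%SET by rewrite -E !inE eqxx.
have : y \in [set a; b]%SET by rewrite -E !inE eqxx orbT.
rewrite !inE => /orP[]/eqP yE /orP[]/eqP xE; move: yx; rewrite xE yE ?eqxx//; by [left|right].
Qed.

Lemma card3_neq (x y z : I) : (#|[set x; y; z]%SET| == 3) = [&& x != y, x != z & y != z].
Proof.
rewrite finset.setUC cardsU1 !inE cards2 [z == x]eq_sym [z == y]eq_sym.
by case: (x == y); case: (x == z); case: (y == z).
Qed.

Lemma sum_ordered_triples (f : {set I} -> V) :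
  \sum_i \sum_j \sum_(k | #|[set i; j; k]%SET| == 3) f [set i; j; k]%SET
  = (\sum_(t : {set I} | #|t| == 3) f t) *+ 6.
Proof.
under eq_bigr do rewrite pair_big_dep/=.
rewrite pair_big_dep/= -sumrMnl.
rewrite (partition_big (fun p : I * (I * I) => [set p.1; p.2.1; p.2.2]%SET)
   (fun e : {set I} => #|e| == 3)); last by [].
apply: eq_bigr => t t3.
rewrite (eq_bigr (fun=> f t)); last by move=> p /andP[_ /eqP->].
rewrite sumr_const; congr (_ *+ _).
have [a [b [c [E abc]]]] : exists a b c, t = [set a; b; c]%SET /\ [&& a != b, a != c & b != c].
  have /card_gt0P[a at_] : (0 < #|t|)%N by rewrite (eqP t3).
  have : #|t :\ a| == 2 by have := cardsD1 a t; rewrite at_ (eqP t3) add1n => -[<-].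
  move=> /cards2P[b [c [bc E]]]; exists a, b, c.
  have E' : t = [set a; b; c]%SET by rewrite -finset.setUA -E finset.setD1K.
  by split=> //; rewrite -card3_neq -E'.
transitivity #|[:: (a, (b, c)); (a, (c, b)); (b, (a, c)); (b, (c, a)); (c, (a, b));
   (c, (b, a))]|.
  apply: eq_card => -[x [y z]]; rewrite !inE/= !xpair_eqE E.
  apply/andP/idP => [[/= + /eqP D]|].
    rewrite card3_neq.
    have : x \in [set a; b; c]%SET by rewrite -D !inE eqxx.
    have : y \in [set a; b; c]%SET by rewrite -D !inE eqxx ?orbT.
    have : z \in [set a; b; c]%SET by rewrite -D !inE eqxx ?orbT.
    rewrite !inE => /orP[/orP[]|] /eqP-> /orP[/orP[]|] /eqP-> /orP[/orP[]|] /eqP->;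
    by rewrite ?eqxx ?orbT ?andbF.
  have s3 (x' y' z' : I) : [set x'; y'; z']%SET = [set y'; x'; z']%SET.
    by rewrite (finset.setUC [set x']%SET).
  have s4 (x' y' z' : I) : [set x'; y'; z']%SET = [set x'; z'; y']%SET.
    by rewrite -!finset.setUA (finset.setUC [set y']%SET).
  move=> H; suff -> : [set x; y; z]%SET = [set a; b; c]%SET by rewrite card3_neq.
  case/or4P: H => [|||/or3P[]]; case/and3P => /eqP-> /eqP-> /eqP->.
  - by [].
  - by rewrite s4.
  - by rewrite s3.
  - by rewrite s4 s3.
  - by rewrite s3 s4.
  - by rewrite s3 s4 s3.
case/and3P: abc => ab ac bc; apply: (card_uniqP _).
rewrite /= !inE !xpair_eqE; move: ab ac bc; rewrite ?eqxx.
rewrite [b == a]eq_sym [c == a]eq_sym [c == b]eq_sym.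
by move=> /negPf-> /negPf-> /negPf->; rewrite ?andbF.
Qed.
End Counting.

(** * Triangulated closed surfaces *)

Section CyclicNeighbours.
Variable I : eqType.

(** A polygon with at least three vertices has no loops and no double edges. *)
Lemma next_next_neq (c : seq I) y : uniq c -> (2 < size c)%N -> y \in c ->
  [/\ next c y != y, next c y \in c & next c (next c y) != y].
Proof.
move=> uc sc yc; have [i s E] := rot_to yc.
have us : uniq (y :: s) by rewrite -E rot_uniq.
have ss : (2 < size (y :: s))%N by rewrite -E size_rot.
have nE z : next c z = next (y :: s) z by rewrite -E next_rot.
rewrite mem_next yc; case: s us ss {E} nE => [//|a [//|b s]] us _ nE.
move: us; rewrite !cons_uniq !inE !negb_or => /and3P[/and3P[ya yb ys] /andP[ab as_] _].
have E1 : next c y = a by rewrite nE /= eqxx.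
have E2 : next c a = b by rewrite nE /= (eq_sym a) (negPf ya) eqxx.
by rewrite E1 E2 ![_ == y]eq_sym ya yb.
Qed.

End CyclicNeighbours.

Section SurfaceCombinatorics.
Variables (N : nat) (T : {set {set 'I_N}}).
Hypothesis surfT : closed_surface_triangulation T.
Implicit Types i j k : 'I_N.

Definition tri i j k := [set i; j; k]%SET \in triangles T.

Definition edge i j := [set i; j]%SET \in edges T.

Lemma triE i j k : tri i j k =
  [&& [set i; j; k]%SET \in T, i != j, i != k & j != k].
Proof. by rewrite /tri inE card3_neq. Qed.

Lemma tri_swap12 i j k : tri i j k = tri j i k.
Proof. by rewrite /tri (finset.setUC [set i]%SET). Qed.

Lemma tri_swap23 i j k : tri i j k = tri i k j.
Proof. by rewrite /tri -!finset.setUA (finset.setUC [set j]%SET). Qed.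

Lemma tri_rot i j k : tri i j k = tri j k i.
Proof. by rewrite tri_swap12 tri_swap23. Qed.

Lemma edgeE i j : edge i j = ([set i; j]%SET \in T) && (i != j).
Proof. by rewrite /edge inE cards2; case: (i == j). Qed.

Lemma face_closed (s t : {set 'I_N}) : t \in T -> s \subset t -> s != finset.set0 ->
  s \in T.
Proof. by case: surfT => -[_ _ h] _; apply: h. Qed.

Lemma tri_edge i j k : tri i j k -> edge i j.
Proof.
rewrite triE edgeE => /and4P[tT -> _ _]; rewrite andbT.
apply: face_closed tT _ _; first by rewrite finset.subsetUl.
by apply/finset.set0Pn; exists i; rewrite !inE eqxx.
Qed.

(** In the link of i, the triangles at i become edges. *)
Lemma tri_link i y z : tri i y z = (y != z) && ([set y; z]%SET \in vertex_link T i).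
Proof.
rewrite triE !inE negb_or -finset.setUA.
have [->//=|yz /=] := eqVneq y z; first by rewrite !andbF.
rewrite andbT; apply/and3P/and3P => [[tT iy iz]|[_ /andP[iy iz] tT]]; last first.
  by split.
split; rewrite ?iy//.
apply: face_closed tT _ _; first by rewrite finset.subsetUr.
by apply/finset.set0Pn; exists y; rewrite !inE eqxx.
Qed.

Lemma edge_link i y : edge i y = ([set y]%SET \in vertex_link T i).
Proof.
rewrite edgeE !inE; case: surfT => -[_ -> _] _ /=.
by rewrite andbC.
Qed.

(** The polygon c is the link of i.  Its vertices are the neighbours of i, and
    the triangles on the edge iy correspond to the two polygon neighbours of
    y. *)
Lemma tri_next_prev i : exists c : seq 'I_N, [/\ uniq c, (2 < size c)%N,
  forall y, edge i y = (y \in c) &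
  forall y z, y \in c -> tri i y z = (z == next c y) || (z == prev c y)].
Proof.
case: (surfT) => _ /(_ i)[c [uc sc E]]; exists c; split=> // [y|y z yc].
  rewrite edge_link E inE; apply/orP/idP => [[/imsetP[x xc /finset.set1_inj->]//|]|yc].
    move=> /imsetP[x xc] /(congr1 (fun A : {set 'I_N} => #|A|)).
    have [nx _ _] := next_next_neq uc sc xc.
    by rewrite cards1 cards2 eq_sym nx.
  by left; apply/imsetP; exists y.
have [ny nyc nny] := next_next_neq uc sc yc.
rewrite tri_link E inE; apply/andP/orP => [[yz /orP[]]|].
- move=> /imsetP[x xc] /(congr1 (fun A : {set 'I_N} => #|A|)).
  by rewrite cards1 cards2 yz.
- move=> /imsetP[x xc Exz].
  have : y \in [set x; next c x]%SET by rewrite -Exz !inE eqxx.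
  have : z \in [set x; next c x]%SET by rewrite -Exz !inE eqxx orbT.
  rewrite !inE => /orP[]/eqP zE /orP[]/eqP yE; move: yz; rewrite ?zE ?yE ?eqxx//.
  + by right; rewrite prev_next.
  + by left.
- case=> /eqP->; rewrite 1?[y == _]eq_sym.
    by split=> //; apply/orP; right; apply/imsetP; exists y.
  have pyc : prev c y \in c by rewrite mem_prev.
  have [np _ _] := next_next_neq uc sc pyc.
  move: np; rewrite next_prev// eq_sym => np; rewrite np; split=> //.
  by apply/orP; right; apply/imsetP; exists (prev c y); rewrite // next_prev// finset.setUC.
Qed.

Lemma card_edge_triangles i j : edge i j -> #|[pred k | tri i j k]| = 2.
Proof.
move=> eij; have [c [uc sc ec tc]] := tri_next_prev i.
have jc : j \in c by rewrite -ec.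
transitivity #|[set next c j; prev c j]%SET|.
  by apply: eq_card => k; rewrite !inE tc.
rewrite cards2.
have [_ _ nn] := next_next_neq uc sc jc.
suff -> : next c j != prev c j by [].
by apply: contraNneq nn => ->; rewrite next_prev.
Qed.

Lemma edge_in_triangle i j : edge i j -> exists k, tri i j k.
Proof.
by move=> /card_edge_triangles H; have /card_gt0P[k kP] : (0 < #|[pred k | tri i j k]|)%N;
  [rewrite H|exists k].
Qed.

Lemma vertex_in_triangle i : exists j k, tri i j k.
Proof.
have [c [uc sc ec tc]] := tri_next_prev i.
case: c sc ec {uc tc} => // y c _ ec.
have : edge i y by rewrite ec inE eqxx.
by move=> /edge_in_triangle[k]; exists y, k.
Qed.

(** A larger simplex would put a triangle into the link of one of its vertices,
    which is a circle. *)
Lemma simplex_card (s : {set 'I_N}) : s \in T -> (0 < #|s| <= 3)%N.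
Proof.
move=> sT; have s0 : s != finset.set0.
  by apply: contraTneq sT => ->; case: surfT => -[].
rewrite card_gt0 s0 /= leqNgt; apply/negP => s4.
have /finset.set0Pn[i is_] := s0.
case: (surfT) => _ /(_ i)[c [uc sc E]].
have cD : #|s| = #|s :\ i|.+1 by rewrite (cardsD1 i) is_.
have : s :\ i \in vertex_link T i.
  rewrite !inE eqxx /= finset.setD1K// sT andbT.
  apply: face_closed sT (finset.subD1set _ _) _.
  by rewrite -card_gt0; move: s4; rewrite cD; case: #|_|.
rewrite E inE => /orP[]/imsetP[x _ sE]; move: s4; rewrite cD sE ?cards1 ?cards2//.
by case: (_ != _).
Qed.

(** For I the whole vertex set this is the usual V - E + F. *)
Lemma euler_char_full_subcomplex (I : {set 'I_N}) :
  euler_char (full_subcomplex T I) =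
  #|I|%:Z - (\sum_(e : {set 'I_N} | #|e| == 2) ((e \in T) && (e \subset I))%:Z)
   + \sum_(t : {set 'I_N} | #|t| == 3) ((t \in T) && (t \subset I))%:Z.
Proof.
rewrite /euler_char.
have -> : \sum_(s in full_subcomplex T I) (-1) ^+ #|s|.-1 =
   \sum_(s : {set 'I_N}) (if (s \in T) && (s \subset I) then (-1) ^+ #|s|.-1 else 0) :> int.
  by rewrite -big_mkcond/=; apply: eq_bigl => s; rewrite inE.
rewrite (bigID (fun s : {set 'I_N} => #|s| == 1))/=.
rewrite [X in _ + X](bigID (fun s : {set 'I_N} => #|s| == 2))/=.
rewrite [X in _ + (_ + X)](bigID (fun s : {set 'I_N} => #|s| == 3))/=.
rewrite [X in _ + (_ + (_ + X))]big1 ?addr0; last first.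
  move=> s; rewrite -!andbA => /and3P[n1 n2 n3]; case: ifP => // /andP[sT _].
  have := simplex_card sT; move: n1 n2 n3.
  by case: #|s| => [//|[//|[//|[//|?]]]].
rewrite addrA; congr (_ + _ + _).
- rewrite (eq_bigr (fun s : {set 'I_N} => (s \subset I)%:Z)); last first.
    move=> s /cards1P[x ->]; rewrite cards1 /=; case: surfT => -[_ -> _] _ /=.
    by case: (_ \subset _).
  transitivity (\sum_(i : 'I_N) (i \in I)%:Z); last first.
    rewrite (eq_bigr (fun i => if i \in I then 1 else 0)); last by move=> i _; case: ifP.
    by rewrite -big_mkcond/= sumr_const natz.
  have -> : \sum_(s : {set 'I_N} | #|s| == 1) (s \subset I)%:Z =
    \sum_(s in [set [set x] | x in [set: 'I_N]]%SET) (s \subset I)%:Z.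
    apply: eq_bigl => s; apply/cards1P/imsetP => [[x ->]|[x _ ->]]; by exists x.
  rewrite big_imset/=; last by move=> x y _ _; exact: finset.set1_inj.
  rewrite (eq_bigl predT); last by move=> x; rewrite inE.
  by apply: eq_bigr => i _; rewrite finset.sub1set.
- rewrite -sumrN; apply: eq_big => s; first by case: eqP => [->|].
  by move=> /andP[_ /eqP->]; case: ifP.
- apply: eq_big => s; first by case: eqP => [->|]; rewrite ?andbF ?andbT//= => _; case: eqP => // ->.
  by move=> /andP[_ /eqP->]; case: ifP.
Qed.

End SurfaceCombinatorics.

(** * Sums over ordered triangles *)

Section TriangleSums.
Variables (R : realType) (N : nat) (T : {set {set 'I_N}}).
Hypothesis surfT : closed_surface_triangulation T.
Implicit Types (i j k : 'I_N) (f g : 'I_N -> 'I_N -> 'I_N -> R) (I : {set 'I_N}).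

(** Each triangle contributes six terms, which makes symmetrization a matter
    of renaming summation variables. *)
Definition sum3 f : R := \sum_i \sum_j \sum_(k | tri T i j k) f i j k.

Lemma eq_sum3 f g : (forall i j k, tri T i j k -> f i j k = g i j k) -> sum3 f = sum3 g.
Proof. by move=> h; do 2![apply: eq_bigr => ? _]; apply: eq_bigr => k; apply: h. Qed.

Lemma le_sum3 f g : (forall i j k, tri T i j k -> f i j k <= g i j k) -> sum3 f <= sum3 g.
Proof. by move=> h; do 2![apply: ler_sum => ? _]; apply: ler_sum => k; apply: h. Qed.

Lemma sum3D f g : sum3 (fun i j k => f i j k + g i j k) = sum3 f + sum3 g.
Proof.
rewrite /sum3 -big_split; apply: eq_bigr => i _; rewrite -big_split.
by apply: eq_bigr => j _; rewrite -big_split.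
Qed.

Lemma sum3Z a f : sum3 (fun i j k => a * f i j k) = a * sum3 f.
Proof.
rewrite /sum3 big_distrr; apply: eq_bigr => i _; rewrite big_distrr.
by apply: eq_bigr => j _; rewrite big_distrr.
Qed.

Lemma sum3N f : sum3 (fun i j k => - f i j k) = - sum3 f.
Proof. by rewrite -mulN1r -sum3Z; apply: eq_sum3 => *; rewrite mulN1r. Qed.

Lemma sum3_swap12 f : sum3 f = sum3 (fun i j k => f j i k).
Proof.
rewrite /sum3 exchange_big; apply: eq_bigr => i _; apply: eq_bigr => j _ /=.
by apply: eq_bigl => k; rewrite tri_swap12.
Qed.

Lemma sum3_swap23 f : sum3 f = sum3 (fun i j k => f i k j).
Proof.
rewrite /sum3; apply: eq_bigr => i _; rewrite (exchange_big_dep predT)//=.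
by apply: eq_bigr => j _; apply: eq_bigl => k; rewrite tri_swap23.
Qed.

Lemma sum3_rot f : sum3 f = sum3 (fun i j k => f k i j).
Proof. by rewrite sum3_swap12 sum3_swap23. Qed.

Lemma sum3_symmetrize f :
  sum3 f = 3^-1 * sum3 (fun i j k => f i j k + f j i k + f k i j).
Proof.
by rewrite !sum3D -(sum3_swap12 f) -(sum3_rot f); field.
Qed.

(** Valued in R, to enter sums of angles. *)
Definition ind I i : R := (i \in I)%:R.

Definition edge_count I : R :=
  \sum_(e : {set 'I_N} | #|e| == 2) ((e \in T) && (e \subset I))%:R.

Definition triangle_count I : R :=
  \sum_(t : {set 'I_N} | #|t| == 3) ((t \in T) && (t \subset I))%:R.

Lemma euler_char_countE I :
  (euler_char (full_subcomplex T I))%:~R = #|I|%:R - edge_count I + triangle_count I.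
Proof.
rewrite (euler_char_full_subcomplex surfT) !(rmorphD, rmorphN)/= !rmorph_sum/=.
by rewrite -!pmulrn.
Qed.

(** Each edge lies in two triangles and is met in two orders. *)
Lemma sum3_ind2 I : sum3 (fun i j k => ind I i * ind I j) = 4 * edge_count I.
Proof.
have -> : 4 * edge_count I = 2 * (edge_count I *+ 2) by rewrite -[edge_count I *+ 2]mulr_natl; ring.
rewrite -sum_ordered_pairs mulr_sumr; apply: eq_bigr => i _.
rewrite [in RHS]big_mkcond mulr_sumr/=; apply: eq_bigr => j _.
rewrite sumr_const; case: ifP => ij; last first.
  rewrite mulr0; have -> : #|[pred k | tri T i j k]| = 0%N; last by rewrite mulr0n.
  by apply: eq_card0 => k; rewrite !inE triE eq_sym ij !andbF.
have [eij|neij] := boolP (edge T i j).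
  rewrite (card_edge_triangles surfT eij) -[LHS]mulr_natl; congr (_ * _).
  move: eij; rewrite edgeE => /andP[-> _] /=.
  by rewrite finset.subUset !finset.sub1set -mulnb natrM.
have -> : #|[pred k | tri T i j k]| = 0%N.
  by apply: eq_card0 => k; rewrite inE; apply: contraNF neij; apply: tri_edge.
move: neij; rewrite edgeE (eq_sym i) ij andbT => /negPf->.
by rewrite mulr0.
Qed.

Lemma sum3_ind3 I : sum3 (fun i j k => ind I i * ind I j * ind I k) = 6 * triangle_count I.
Proof.
rewrite mulr_natl -sum_ordered_triples; apply: eq_bigr => i _; apply: eq_bigr => j _.
rewrite [LHS]big_mkcond [RHS]big_mkcond; apply: eq_bigr => k _.
rewrite /tri inE; case: (#|_| == 3); rewrite ?andbF// andbT.
case: (_ \in T) => //=.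
by rewrite !finset.subUset !finset.sub1set -!mulnb !natrM.
Qed.

Variable Phi : {set 'I_N} -> R.

(** The angle at i in the limit where the circle i shrinks to a point while
    the circles j and k, outside I, do not. *)
Definition link_term I i j k : R :=
  ind I i * (1 - ind I j) * (1 - ind I k) * (pi - Phi [set j; k]%SET).

Lemma sum_LkE I : \sum_(p in Lk T I) (pi - Phi p.1) = 2^-1 * sum3 (link_term I).
Proof.
(* Extended by 0, to sum over all pairs of a vertex and a two-element set. *)
pose F i (e : {set 'I_N}) : R :=
  if ((e, i) : {set 'I_N} * 'I_N) \in Lk T I then pi - Phi e else 0.
have -> : \sum_(p in Lk T I) (pi - Phi p.1) = \sum_i \sum_(e : {set 'I_N} | #|e| == 2) F i e.
  rewrite big_mkcond; under [in RHS]eq_bigr do rewrite big_mkcond.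
  rewrite exchange_big pair_big; apply: eq_bigr => -[e i] _ /=.
  rewrite /F; case: ifP => // eL; case: ifP => //.
  by move: eL; rewrite !inE => /andP[/andP[_ ->]].
have -> : sum3 (link_term I) = \sum_i \sum_j \sum_(k | k != j) F i [set j; k]%SET; last first.
  rewrite mulr_sumr; apply: eq_bigr => i _.
  rewrite sum_ordered_pairs; move: (\sum_(e : {set 'I_N} | _) _) => x.
  by rewrite -[x *+ 2]mulr_natl mulrA mulVf// mul1r.
apply: eq_bigr => i _; apply: eq_bigr => j _.
rewrite [LHS]big_mkcond [RHS]big_mkcond; apply: eq_bigr => k _.
rewrite /F /link_term /ind inE/=.
have -> : (i |: [set j; k])%SET \in triangles T = tri T i j k.
  by rewrite /tri finset.setUA.
have [t|nt] := boolP (tri T i j k); last by rewrite !andbF; case: ifP.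
have ejk : [set j; k]%SET \in edges T by apply: (@tri_edge _ _ surfT j k i); rewrite -tri_rot.
have jk : k != j by move: t; rewrite triE (eq_sym j) => /and4P[].
rewrite jk ejk /= andbT -finset.setI_eq0.
have -> : (([set j; k] :&: I)%SET == finset.set0) = (j \notin I) && (k \notin I).
  apply/eqP/andP => [E|[jI kI]].
    split; apply/negP => xI.
      by have := finset.in_set0 j; rewrite -E !inE eqxx xI.
    by have := finset.in_set0 k; rewrite -E !inE eqxx orbT xI.
  apply/finset.setP => x; rewrite !inE; apply/andP => -[/orP[]/eqP->]; exact/negP.
by case: (i \in I); case: (j \in I); case: (k \in I) => /=;
  rewrite ?subrr ?subr0 ?mulr0 ?mul0r ?mul1r ?mulr1.
Qed.

(** The total angle at the vertices of I of the triangle ijk, in the limit where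
    the circles of I shrink to points: pi if I contains two or three of the
    vertices, since the angle at a huge circle tends to 0, and pi minus the
    weight of the opposite edge if I contains one. *)
Definition lim_angles I i j k : R :=
  pi * (ind I i * ind I j + ind I i * ind I k + ind I j * ind I k
         - 2 * (ind I i * ind I j * ind I k))
  + (link_term I i j k + link_term I j i k + link_term I k i j).

(** Counting the edges inside I through the triangles that contain them gives
    2 e = 3 f + f', with f' the number of triangles with exactly two vertices
    in I; this converts the number f + f' of triangles that contribute pi
    into the Euler characteristic |I| - e + f of the subcomplex. *)
Lemma lim_angles_sum I :
  2 * pi * #|I|%:R - 6^-1 * sum3 (lim_angles I) =
  - (\sum_(p in Lk T I) (pi - Phi p.1)) + 2 * pi * (euler_char (full_subcomplex T I))%:~R.
Proof.
rewrite sum_LkE euler_char_countE (sum3_symmetrize (link_term I)).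
have -> : sum3 (lim_angles I) = pi * (3 * (4 * edge_count I) - 2 * (6 * triangle_count I))
   + sum3 (fun i j k => link_term I i j k + link_term I j i k + link_term I k i j).
  pose f12 i j k := ind I i * ind I j; pose f13 i j k := ind I i * ind I k.
  pose f23 i j k := ind I j * ind I k.
  pose f123 i j k := ind I i * ind I j * ind I k.
  rewrite (sum3D (fun i j k => pi * (f12 i j k + f13 i j k + f23 i j k - 2 * f123 i j k))).
  congr (_ + _).
  rewrite (sum3Z pi (fun i j k => f12 i j k + f13 i j k + f23 i j k - 2 * f123 i j k)).
  rewrite (sum3D (fun i j k => f12 i j k + f13 i j k + f23 i j k)).
  rewrite sum3N (sum3Z 2 f123) sum3_ind3 !sum3D (sum3_swap23 f13) (sum3_rot f23).
  by rewrite sum3_ind2; ring.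
by field.
Qed.

End TriangleSums.

(** * Curvature: Gauss-Bonnet and the inequalities of Thurston *)

Section Curvature.
Variables (R : realType) (N : nat) (T : {set {set 'I_N}}).
Hypothesis surfT : closed_surface_triangulation T.
Variable Phi : {set 'I_N} -> R.
Hypothesis wPhi : is_weight T Phi.
Implicit Types (i j k : 'I_N) (I : {set 'I_N}) (r x u v : 'I_N -> R).

Let cw i j := cos (Phi [set i; j]%SET).

Lemma cwC i j : cw i j = cw j i.
Proof. by rewrite /cw finset.setUC. Qed.

Lemma tri_edges i j k : tri T i j k -> [/\ edge T i j, edge T i k & edge T j k].
Proof.
move=> t; split; first exact: tri_edge t.
  by rewrite tri_swap23 in t; exact: tri_edge t.
by rewrite tri_rot in t; exact: tri_edge t.
Qed.

Lemma cw_bounds i j : edge T i j -> 0 <= cw i j <= 1.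
Proof. by move=> e; apply: cos_weight; apply: wPhi. Qed.

Lemma edge_length_sym r i j : edge_length Phi r i j = edge_length Phi r j i.
Proof.
by rewrite /edge_length finset.setUC; congr (Num.sqrt _); ring.
Qed.

Lemma inner_angle_sym r i j k : inner_angle Phi r i j k = inner_angle Phi r i k j.
Proof.
by rewrite /inner_angle (edge_length_sym r j k); congr (acos (_ / _)); ring.
Qed.

Lemma inner_angleE r i j k : (forall l, 0 < r l) -> tri T i j k ->
  inner_angle Phi r i j k = rangle (cw i j) (cw i k) (cw j k) (r i) (r j) (r k).
Proof.
move=> r0 /tri_edges[/cw_bounds/andP[eij _] /cw_bounds/andP[eik _] /cw_bounds/andP[ejk _]].
rewrite /inner_angle /rangle /tri_cos /edge_length -/(cw i j) -/(cw i k) -/(cw j k).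
by rewrite -!/(sqlen _ _ _) !sqr_sqrtr// ltW// sqlen_gt0.
Qed.

Lemma inner_angle_bounds r i j k : (forall l, 0 < r l) -> tri T i j k ->
  0 < inner_angle Phi r i j k < pi.
Proof.
move=> r0 t; rewrite inner_angleE//.
by case: (tri_edges t) => /cw_bounds ? /cw_bounds ? /cw_bounds ?; apply: rangle_bounds.
Qed.

Lemma inner_angle_sum r i j k : (forall l, 0 < r l) -> tri T i j k ->
  inner_angle Phi r i j k + inner_angle Phi r j i k + inner_angle Phi r k i j = pi.
Proof.
move=> r0 t; have t1 := t; have t2 := t; rewrite tri_swap12 in t1; rewrite -tri_rot in t2.
rewrite !inner_angleE// (cwC j i) (cwC k i) (cwC k j).
by case: (tri_edges t) => /cw_bounds ? /cw_bounds ? /cw_bounds ?; apply: rangle_sum.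
Qed.

Lemma angle_sumE r i :
  angle_sum T Phi r i = 2^-1 * \sum_j \sum_(k | tri T i j k) inner_angle Phi r i j k.
Proof.
have E : \sum_j \sum_(k | tri T i j k) inner_angle Phi r i j k =
   angle_sum T Phi r i + \sum_(j < N) \sum_(k < N | (k < j)%N && tri T i j k) inner_angle Phi r i j k.
  rewrite /angle_sum -big_split; apply: eq_bigr => j _ /=.
  rewrite (bigID (fun k : 'I_N => (j < k)%N))/=; congr (_ + _).
    by apply: eq_bigl => k; rewrite andbC.
  apply: eq_bigl => k; rewrite -leqNgt andbC leq_eqVlt.
  case: (tri T i j k) / boolP => [t|]; rewrite ?andbF// !andbT.
  case: eqVneq => // /val_inj kj; move: t.
  by rewrite kj triE eqxx !andbF.
have E2 : \sum_(j < N) \sum_(k < N | (k < j)%N && tri T i j k) inner_angle Phi r i j k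
   = angle_sum T Phi r i.
  rewrite (exchange_big_dep predT)//=; apply: eq_bigr => j _.
  apply: eq_big => k; first by rewrite tri_swap23.
  by rewrite inner_angle_sym.
by rewrite E E2; field.
Qed.

Definition tri_pairing x r i j k : R :=
  x i * inner_angle Phi r i j k + x j * inner_angle Phi r j i k + x k * inner_angle Phi r k i j.

(** Each triangle is met in six orders. *)
Lemma angle_sum_pairing x r :
  \sum_i x i * angle_sum T Phi r i = 6^-1 * sum3 T (tri_pairing x r).
Proof.
have -> : \sum_i x i * angle_sum T Phi r i =
    2^-1 * sum3 T (fun i j k => x i * inner_angle Phi r i j k).
  rewrite mulr_sumr; apply: eq_bigr => i _; rewrite angle_sumE mulrCA; congr (_ * _).
  by rewrite mulr_sumr; apply: eq_bigr => j _; rewrite mulr_sumr.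
rewrite sum3_symmetrize mulrA; congr (_ * _); by field.
Qed.

Definition kav : R := 2 * pi * (euler_char T)%:~R / N%:R.

(** The case of I equal to the whole vertex set in [lim_angles_sum]: there all
    the degenerate angle sums are pi, as are the actual ones, and the link
    term is empty. *)
Lemma gauss_bonnet r : (forall l, 0 < r l) ->
  \sum_i curvature T Phi r i = 2 * pi * (euler_char T)%:~R.
Proof.
move=> r0.
have := lim_angles_sum surfT Phi [set: 'I_N]%SET.
rewrite big_pred0; last first.
  move=> [e v]; rewrite !inE/=; apply/negP => /andP[/andP[_ /eqP e2] /andP[dis _]].
  have /card_gt0P[x xe] : (0 < #|e|)%N by rewrite e2.
  by have := disjointFr dis xe; rewrite inE.
have -> : full_subcomplex T [set: 'I_N]%SET = T.
  by apply/finset.setP => s; rewrite inE finset.subsetT andbT.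
rewrite oppr0 add0r => <-; rewrite /curvature sumrB sumr_const cardsT -[(2 * pi) *+ _]mulr_natr; congr (_ - _).
rewrite (eq_bigr (fun i => 1 * angle_sum T Phi r i)); last by move=> *; rewrite mul1r.
rewrite (angle_sum_pairing (fun=> 1)); congr (_ * _); apply: eq_sum3 => i j k t.
rewrite /tri_pairing !mul1r inner_angle_sum// /lim_angles /link_term /ind !inE/= !mulr1n.
by ring.
Qed.

Lemma average_curvatureE r : (forall l, 0 < r l) -> average_curvature T Phi r = kav.
Proof. by move=> r0; rewrite /average_curvature gauss_bonnet. Qed.

Lemma ind_sum I r : \sum_(i in I) angle_sum T Phi r i = 6^-1 * sum3 T (tri_pairing (ind R I) r).
Proof.
rewrite -angle_sum_pairing big_mkcond; apply: eq_bigr => i _; rewrite /ind.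
by case: ifP; rewrite ?mul1r ?mul0r.
Qed.

Lemma sum3_ge_term (f : 'I_N -> 'I_N -> 'I_N -> R) i j k :
  (forall i j k, tri T i j k -> 0 <= f i j k) -> tri T i j k -> f i j k <= sum3 T f.
Proof.
move=> f0 t; rewrite /sum3 (bigD1 i)//= (bigD1 j)//= (bigD1 k)//= -!addrA lerDl.
have s0 i' j' (P : pred 'I_N) : 0 <= \sum_(k' | tri T i' j' k' && P k') f i' j' k'.
  by apply: sumr_ge0 => k' /andP[? _]; apply: f0.
have s1 i' j' : 0 <= \sum_(k' | tri T i' j' k') f i' j' k'.
  by apply: sumr_ge0 => k' ?; apply: f0.
apply: addr_ge0; first exact: s0.
apply: addr_ge0; apply: sumr_ge0 => ? _; first exact: s1.
by apply: sumr_ge0 => ? _; exact: s1.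
Qed.

Lemma inner_angle_lt r i j k : (forall l, 0 < r l) -> tri T i j k ->
  inner_angle Phi r i j k < pi - Phi [set j; k]%SET.
Proof.
move=> r0 t; rewrite inner_angleE//.
case: (tri_edges t) => /cw_bounds ? /cw_bounds ? e; apply: rangle_lt => //.
exact: wPhi.
Qed.

(** Equality occurs exactly when no two vertices of the triangle are separated
    by I. *)
Lemma tri_pairing_le_lim r I i j k : (forall l, 0 < r l) -> tri T i j k ->
  tri_pairing (ind R I) r i j k <= lim_angles Phi I i j k
    ?= iff ((i \in I) == (j \in I)) && ((i \in I) == (k \in I)).
Proof.
move=> r0 t; have t1 := t; have t2 := t; rewrite tri_swap12 in t1; rewrite -tri_rot in t2.
have /andP[a1 _] := inner_angle_bounds r0 t; have /andP[a2 _] := inner_angle_bounds r0 t1.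
have /andP[a3 _] := inner_angle_bounds r0 t2.
have b1 := inner_angle_lt r0 t; have b2 := inner_angle_lt r0 t1.
have b3 := inner_angle_lt r0 t2; have S := inner_angle_sum r0 t.
apply/leifP; rewrite /tri_pairing /lim_angles /link_term /ind.
by case: (i \in I); case: (j \in I); case: (k \in I) => /=; lra.
Qed.

Hypothesis connT : connected_complex T.

(** Follow a path of the 1-skeleton until it leaves I. *)
Lemma boundary_edge I : I != finset.set0 -> I \proper [set: 'I_N]%SET ->
  exists i j, [/\ i \in I, j \notin I & edge T i j].
Proof.
move=> /finset.set0Pn[a aI] /fintype.properP[_ [b _ bI]].
case: connT => _ /(_ a b)/connectP[p pP bE].
elim: p a aI pP bE => [a aI _ E|c p IH a aI /= /andP[ac pc] E].
  by move: bI; rewrite E aI.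
have [cI|cI] := boolP (c \in I); first exact: IH cI pc E.
exists a, c; split=> //; rewrite edgeE ac /=.
by apply: contraNneq cI => <-.
Qed.

(** Strictness comes from a triangle on an edge that leaves I, which exists by
    connectedness. *)
Lemma thurston_inequality r I : (forall l, 0 < r l) ->
  I != finset.set0 -> I \proper [set: 'I_N]%SET ->
  - (\sum_(p in Lk T I) (pi - Phi p.1)) + 2 * pi * (euler_char (full_subcomplex T I))%:~R
  < \sum_(i in I) curvature T Phi r i.
Proof.
move=> r0 I0 IT; rewrite -lim_angles_sum//.
rewrite /curvature sumrB sumr_const -[(2 * pi) *+ _]mulr_natr ltrD2l ltrN2 ind_sum.
rewrite ltr_pM2l// -subr_gt0 -sum3N -sum3D.
have [i [j [iI jI eij]]] := boundary_edge I0 IT.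
have [k t] := edge_in_triangle surfT eij.
apply: lt_le_trans (sum3_ge_term _ t).
  by rewrite subr_gt0 (lt_leif (tri_pairing_le_lim I r0 t)) iI (negPf jI).
by move=> i' j' k' t'; rewrite subr_ge0 (leif_le (tri_pairing_le_lim I r0 t')).
Qed.

(** The inequality opposite to [tri_pairing_le_lim], up to e, once the circles
    of I are small compared with all others. *)
Lemma tri_pairing_ge_lim r I e q i j k : (forall l, 0 < r l) -> tri T i j k ->
  0 < e -> e <= pi / 2 -> 0 < q -> q <= 1 -> 6 * q < 2 * sin (e / 2) ^+ 2 ->
  (forall a b, a \in I -> b \notin I -> r a <= q * r b) ->
  lim_angles Phi I i j k - e <= tri_pairing (ind R I) r i j k.
Proof.
move=> r0 t e0 e1 q0 q1 qe rI.
have lo a b c : tri T a b c -> a \in I -> b \notin I -> c \notin I ->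
    pi - Phi [set b; c]%SET - e <= inner_angle Phi r a b c.
  move=> t' aI bI cI; rewrite inner_angleE//.
  case: (tri_edges t') => /cw_bounds ? /cw_bounds ? ebc.
  by apply: (@rangle_ge _ _ _ _ _ _ _ _ q) => //; [exact: wPhi|exact: rI|exact: rI].
have hi a b c : tri T a b c -> a \notin I -> b \in I -> c \in I ->
    inner_angle Phi r a b c <= e.
  move=> t' aI bI cI; rewrite inner_angleE//.
  case: (tri_edges t') => /cw_bounds ? /cw_bounds ? ebc.
  by apply: (@rangle_le _ _ _ _ _ _ _ _ q) => //; [exact: wPhi|exact: rI|exact: rI].
have t1 := t; have t2 := t; rewrite tri_swap12 in t1; rewrite -tri_rot in t2.
have S := inner_angle_sum r0 t.
have l1 := lo _ _ _ t; have l2 := lo _ _ _ t1; have l3 := lo _ _ _ t2.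
have h1 := hi _ _ _ t; have h2 := hi _ _ _ t1; have h3 := hi _ _ _ t2.
rewrite /tri_pairing /lim_angles /link_term /ind.
move: l1 l2 l3 h1 h2 h3.
case: (i \in I); case: (j \in I); case: (k \in I) => /= l1 l2 l3 h1 h2 h3;
 do ?[move: (l1 isT isT isT) => {}l1 | move: (l2 isT isT isT) => {}l2
    | move: (l3 isT isT isT) => {}l3 | move: (h1 isT isT isT) => {}h1
    | move: (h2 isT isT isT) => {}h2 | move: (h3 isT isT isT) => {}h3]; lra.
Qed.

End Curvature.

(** * Summation by parts along a sorted vector *)

Section FiniteSums.
Variable R : realType.

Lemma positive_lower_bound (F : finType) (P : pred F) (f : F -> R) :
  (forall x, P x -> 0 < f x) -> exists2 d, 0 < d & forall x, P x -> d <= f x.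
Proof.
move=> f0; pose S := 1 + \sum_(x | P x) (f x)^-1.
have S0 : 0 < S.
  by rewrite ltr_pwDl// sumr_ge0// => x Px; rewrite invr_ge0 ltW// f0.
exists S^-1; first by rewrite invr_gt0.
move=> x Px; rewrite -[f x]invrK lef_pV2 ?posrE ?invr_gt0 ?f0//.
rewrite /S (bigD1 x)//= addrCA lerDl addr_ge0// sumr_ge0// => y /andP[Py _].
by rewrite invr_ge0 ltW// f0.
Qed.

Lemma abel_summation (U G : nat -> R) n :
  \sum_(0 <= l < n.+1) U l * G l =
  U n * \sum_(0 <= l < n.+1) G l
  - \sum_(0 <= l < n) (U l.+1 - U l) * \sum_(0 <= m < l.+1) G m.
Proof.
elim: n => [|n IH]; first by rewrite !big_nat1 big_geq// subr0.
rewrite big_nat_recr//= IH [in RHS]big_nat_recr//= [X in _ = _ - X]big_nat_recr//=.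
by ring.
Qed.

(** Sort the coordinates of u and sum by parts: the sum becomes the sum over
    consecutive pairs of (gap) times minus (partial sum of g).  Since the
    partial sum over a set below a gap of size at least D is at most - d, such
    a gap contributes at least d times its size; a smaller gap loses at most
    D (N C + d) compared with that.  The gaps add up to the spread. *)
Lemma gap_abel_bound N (g u : 'I_N -> R) (C D d : R) : 0 <= C -> 0 <= D -> 0 < d ->
  \sum_i g i = 0 -> (forall i, `|g i| <= C) ->
  (forall I : {set 'I_N}, I != finset.set0 -> I \proper [set: 'I_N]%SET ->
    (forall a b, a \in I -> b \notin I -> u a + D <= u b) ->
    \sum_(i in I) g i <= - d) ->
  forall i j, d * (u i - u j) - N%:R * (D * (N%:R * C + d)) <= \sum_i u i * g i.
Proof.
move=> C0 D0 d0 g0 gC gap i j.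
case: N g u g0 gC gap i j => [|n] g u g0 gC gap i j; first by case: i.
pose s := sort (fun a b => u a <= u b) (enum 'I_n.+1).
have ss : size s = n.+1 by rewrite size_sort size_enum_ord.
have us : uniq s by rewrite sort_uniq enum_uniq.
have ms x : x \in s by rewrite mem_sort mem_enum.
pose S l := nth ord0 s l; pose U l := u (S l); pose G l := g (S l).
have U_mono l m : (l <= m)%N -> (m < n.+1)%N -> U l <= U m.
  move=> lm mn; apply: (sorted_leq_nth (leT := fun a b => u a <= u b)) => //.
  - by move=> a b c; apply: le_trans.
  - by apply: sort_sorted => a b; apply: le_total.
  - by rewrite inE ss (leq_ltn_trans lm).
  - by rewrite inE ss.
have sumE (f : 'I_n.+1 -> R) : \sum_i f i = \sum_(0 <= l < n.+1) f (S l).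
  transitivity (\sum_(i <- s) f i).
    by rewrite (perm_big _ (permEl (perm_sort _ _))) big_enum.
  by rewrite (big_nth ord0) ss.
rewrite (sumE (fun i => u i * g i)) (abel_summation U G) -(sumE g) g0 mulr0 add0r -sumrN.
have key l : (l < n)%N ->
   d * (U l.+1 - U l) - D * (n.+1%:R * C + d) <=
   - ((U l.+1 - U l) * \sum_(0 <= m < l.+1) G m).
  move=> ln; set P := \sum_(0 <= m < l.+1) G m.
  have dl : 0 <= U l.+1 - U l by rewrite subr_ge0 U_mono.
  have [small|big] := ltP (U l.+1 - U l) D.
    have PC : `|P| <= n.+1%:R * C.
      rewrite /P; apply: le_trans (ler_norm_sum _ _ _) _.
      apply: le_trans (ler_sum _ (fun m _ => gC _)) _.
      by rewrite sumr_const_nat subn0 -[C *+ _]mulr_natl ler_wpM2r// ler_nat ltnS ltnW.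
    have : (U l.+1 - U l) * `|P| <= D * (n.+1%:R * C) by apply: ler_pM => //; exact: ltW.
    have : (U l.+1 - U l) * P <= (U l.+1 - U l) * `|P|.
      by rewrite ler_wpM2l// ler_norm.
    have : d * (U l.+1 - U l) <= d * D by rewrite ler_pM2l// ltW.
    lra.
  have Pd : P <= - d.
    pose I := [set x in take l.+1 s]%SET.
    have szt : size (take l.+1 s) = l.+1 by rewrite size_take ss ltnS ln.
    have -> : P = \sum_(x in I) g x.
      transitivity (\sum_(x <- take l.+1 s) g x).
        rewrite (big_nth ord0) szt; apply: eq_big_nat => m /andP[_ ml].
        by rewrite nth_take.
      rewrite big_uniq ?take_uniq//=; apply: eq_bigl => x.
      by rewrite inE.
    have inI m : (m < n.+1)%N -> (S m \in I) = (m < l.+1)%N.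
      by move=> mn; rewrite inE in_take ?ms// index_uniq ?ss.
    have exS x : exists2 m, (m < n.+1)%N & x = S m.
      have := ms x; rewrite -index_mem ss => xs.
      by exists (index x s); rewrite // /S nth_index.
    apply: gap.
    - by apply/finset.set0Pn; exists (S 0%N); rewrite inI.
    - apply/fintype.properP; split; first exact: finset.subsetT.
      by exists (S l.+1); [rewrite inE|rewrite inI ?ltnn// ltnS].
    - move=> a b; have [p pn ->] := exS a; have [q qn ->] := exS b.
      rewrite !inI// -leqNgt ltnS => pl lq.
      apply: le_trans (U_mono _ _ lq qn).
      apply: (@le_trans _ _ (U l + D)).
        by rewrite lerD2r; apply: U_mono => //; rewrite ltnS ltnW.
      by rewrite -lerBrDl.
  have : (U l.+1 - U l) * P <= (U l.+1 - U l) * - d by rewrite ler_wpM2l.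
  have : 0 <= D * (n.+1%:R * C + d) by rewrite mulr_ge0// addr_ge0 ?mulr_ge0// ltW.
  lra.
have := @ler_sum_nat R 0 n _ _ (fun l ln => key l (andP ln).2).
rewrite big_split/= -mulr_sumr telescope_sumr// sumr_const_nat subn0 => H.
apply: le_trans H.
have Ui x : U 0%N <= u x <= U n.
  have := ms x; rewrite -index_mem ss => xs.
  have -> : u x = U (index x s) by rewrite /U /S nth_index.
  by rewrite !U_mono.
have /andP[_ ui] := Ui i; have /andP[uj _] := Ui j.
apply: lerD; first by rewrite ler_pM2l// lerB.
rewrite -[_ *+ n]mulr_natl mulrN lerN2 ler_wpM2r ?ler_nat//.
by rewrite mulr_ge0// addr_ge0 ?mulr_ge0// ltW.
Qed.

End FiniteSums.

(** * Curvature as a function of the logarithms of the radii *)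

Section LogCurvature.
Variables (R : realType) (N : nat) (T : {set {set 'I_N}}).
Hypothesis surfT : closed_surface_triangulation T.
Hypothesis connT : connected_complex T.
Variable Phi : {set 'I_N} -> R.
Hypothesis wPhi : is_weight T Phi.
Implicit Types (i j k : 'I_N) (I : {set 'I_N}) (r x u v : 'I_N -> R).

Definition lcurv u i := curvature T Phi (fun l => expR (u l)) i.

Local Notation K0 := (kav R T).

Lemma N_gt0 : 0 < N%:R :> R.
Proof. by case: connT => N0 _; rewrite ltr0n. Qed.

Let expR_pos u (l : 'I_N) : 0 < expR (u l). Proof. exact: expR_gt0. Qed.

Lemma lcurv_sum u : \sum_i (lcurv u i - K0) = 0.
Proof.
rewrite sumrB /lcurv gauss_bonnet// sumr_const card_ord -[K0 *+ N]mulr_natr /kav.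
by rewrite divfK ?subrr// gt_eqF// N_gt0.
Qed.

Lemma lcurv_lipschitz : exists2 L, 0 < L &
  forall u v i, `|lcurv u i - lcurv v i| <= L * \sum_j `|u j - v j|.
Proof.
exists (15 * N%:R ^+ 2) => [|u v i].
  by rewrite mulr_gt0 ?exprn_gt0 ?N_gt0.
set D := \sum_j _; have D0 : 0 <= D by apply: sumr_ge0 => j _; rewrite normr_ge0.
have Dj j : `|u j - v j| <= D by rewrite /D (bigD1 j)//= lerDl sumr_ge0.
have -> : lcurv u i - lcurv v i = - 2^-1 * \sum_j \sum_(k | tri T i j k)
   (inner_angle Phi (expR \o u) i j k - inner_angle Phi (expR \o v) i j k).
  rewrite /lcurv /curvature !angle_sumE//.
  under [in RHS]eq_bigr do rewrite sumrB.
  by rewrite sumrB; ring.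
rewrite normrM normrN [`|2^-1|]ger0_norm ?invr_ge0//.
have : `|\sum_j \sum_(k | tri T i j k)
   (inner_angle Phi (expR \o u) i j k - inner_angle Phi (expR \o v) i j k)|
   <= \sum_(j < N) \sum_(k < N) 30 * D.
  apply: le_trans (ler_norm_sum _ _ _) _; apply: ler_sum => j _.
  apply: le_trans (ler_norm_sum _ _ _) _; rewrite big_mkcond; apply: ler_sum => k _.
  case: ifP => t; last by rewrite mulr_ge0.
  rewrite !(inner_angleE surfT wPhi)//; [|exact: expR_pos|exact: expR_pos].
  case: (tri_edges surfT t) => /(cw_bounds wPhi) ? /(cw_bounds wPhi) ? /(cw_bounds wPhi) ?.
  apply: le_trans (rangle_lipschitz _ _ _ _ _ _ _ _ _) _ => //.
  have := Dj i; have := Dj j; have := Dj k; lra.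
rewrite !sumr_const !card_ord -mulrnA -[(30 * D) *+ _]mulr_natr natrM => h.
by apply: le_trans (ler_wpM2l _ h) _; rewrite ?invr_ge0//; lra.
Qed.

Lemma lcurv_bounded : exists2 M, 0 < M & forall u i, `|lcurv u i - K0| <= M.
Proof.
pose A : R := 2^-1 * (N%:R * (N%:R * pi)).
have pp := pi_gt0 R.
have A0 : 0 <= A by rewrite !mulr_ge0 ?invr_ge0// ltW.
exists (2 * pi + A + `|K0|) => [|u i]; first by have := normr_ge0 K0; lra.
apply: le_trans (ler_normB _ _) _; rewrite lerD2r.
apply: le_trans (ler_normB _ _) _; rewrite ger0_norm; last lra.
rewrite lerD2l angle_sumE// normrM [`|2^-1|]ger0_norm ?invr_ge0// /A ler_pM2l//.
apply: le_trans (ler_norm_sum _ _ _) _.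
apply: (@le_trans _ _ (\sum_(j < N) \sum_(k < N) pi)); last first.
  by rewrite !sumr_const !card_ord -[_ *+ N]mulr_natl -[pi *+ N]mulr_natl.
apply: ler_sum => j _; apply: le_trans (ler_norm_sum _ _ _) _.
rewrite big_mkcond; apply: ler_sum => k _; case: ifP => t; last exact: ltW.
have /andP[a b] := inner_angle_bounds surfT wPhi (expR_pos u) t.
by rewrite ger0_norm ltW.
Qed.

Definition tri_dirichlet r x i j k : R :=
  let c a b := cos (Phi [set a; b]%SET) in
  dirichlet (c i j) (c i k) (c j k) (r i) (r j) (r k) (x i) (x j) (x k).

Lemma tri_pairing_variation u v i j k : tri T i j k -> exists2 s, 0 <= s <= 1 &
  tri_pairing Phi (fun l => u l - v l) (fun l => expR (u l)) i j k
  - tri_pairing Phi (fun l => u l - v l) (fun l => expR (v l)) i j k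
  = - tri_dirichlet (fun l => expR (v l + s * (u l - v l))) (fun l => u l - v l) i j k.
Proof.
move=> t; have t1 := t; have t2 := t; rewrite tri_swap12 in t1; rewrite -tri_rot in t2.
case: (tri_edges surfT t) => /(cw_bounds wPhi) e1 /(cw_bounds wPhi) e2 /(cw_bounds wPhi) e3.
have [s s01 E] := rangle_pairing_mean_value e1 e2 e3 (u i) (u j) (u k) (v i) (v j) (v k).
exists s => //; rewrite /tri_dirichlet -E /tri_pairing.
rewrite !(inner_angleE surfT wPhi)//; do ?[exact: expR_pos].
rewrite (cwC Phi j i) (cwC Phi k i) (cwC Phi k j) /=; ring.
Qed.

Lemma tri_dirichlet_ge0 r x i j k : (forall l, 0 < r l) -> tri T i j k ->
  0 <= tri_dirichlet r x i j k.
Proof.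
move=> r0 t.
case: (tri_edges surfT t) => /(cw_bounds wPhi) e1 /(cw_bounds wPhi) e2 /(cw_bounds wPhi) e3.
exact: dirichlet_ge0.
Qed.

Lemma lcurv_pairing u v : \sum_i (u i - v i) * (lcurv u i - lcurv v i) =
  6^-1 * sum3 T (fun i j k =>
     tri_pairing Phi (fun l => u l - v l) (fun l => expR (v l)) i j k
     - tri_pairing Phi (fun l => u l - v l) (fun l => expR (u l)) i j k).
Proof.
rewrite sum3D sum3N mulrBr -!angle_sum_pairing// -sumrB.
by apply: eq_bigr => i _; rewrite /lcurv /curvature; ring.
Qed.

Lemma lcurv_monotone u v : 0 <= \sum_i (u i - v i) * (lcurv u i - lcurv v i).
Proof.
rewrite lcurv_pairing mulr_ge0 ?invr_ge0//.
do 2![apply: sumr_ge0 => ? _]; apply: sumr_ge0 => k t.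
have [s _ E] := tri_pairing_variation u v t.
by rewrite -opprB E opprK; apply: tri_dirichlet_ge0 => // l; exact: expR_gt0.
Qed.

(** A factor 4 per step, from (a + b)^2 <= 2 a^2 + 2 b^2. *)
Lemma path_sqr_bound x (E : R) : (forall i j, edge T i j -> (x i - x j) ^+ 2 <= E) ->
  0 <= E -> forall (p : seq 'I_N) i, path [rel x y | [set x; y]%SET \in T] i p ->
  (x i - x (last i p)) ^+ 2 <= (4 ^+ size p) * 2 * E.
Proof.
move=> eE E0; elim=> [|c p IH] i /=; first by rewrite subrr expr0n/= mul1r mulr_ge0.
move=> /andP[ic /IH {}IH].
have h : (x i - x c) ^+ 2 <= E.
  have [->|n] := eqVneq i c; first by rewrite subrr expr0n.
  by apply: eE; rewrite edgeE ic.
have := sqr_ge0 ((x i - x c) - (x c - x (last c p))).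
have : 1 * E <= 4 ^+ size p * E by rewrite ler_wpM2r// exprn_ege1// ler1n.
rewrite (exprS 4); lra.
Qed.

(** A Poincare inequality for the connected 1-skeleton; the sum over triangles
    counts every edge because every edge lies in a triangle. *)
Lemma poincare : exists2 c, 0 < c & forall x, \sum_i x i = 0 ->
  c * \sum_i x i ^+ 2 <= sum3 T (fun i j k => (x i - x j) ^+ 2).
Proof.
have H i j : exists C : R, 0 <= C /\ forall x,
    (x i - x j) ^+ 2 <= C * sum3 T (fun i j k => (x i - x j) ^+ 2).
  case: connT => _ /(_ i j)/connectP[p pP ->].
  exists (4 ^+ size p * 2); split; first by rewrite mulr_ge0// exprn_ge0.
  move=> x; apply: path_sqr_bound => // [a b e|].
    have [k t] := edge_in_triangle surfT e.
    by apply: (@sum3_ge_term _ _ _ (fun i j k => (x i - x j) ^+ 2) a b k) => // *;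
      rewrite sqr_ge0.
  by do 2![apply: sumr_ge0 => ? _]; apply: sumr_ge0 => *; rewrite sqr_ge0.
have [C CP] := fin_all_exists (fun i => fin_all_exists (H i)).
pose S := 1 + \sum_i \sum_j C i j.
have SC0 : 0 <= \sum_i \sum_j C i j.
  by apply: sumr_ge0 => i _; apply: sumr_ge0 => j _; case: (CP i j).
have S0 : 0 < S by rewrite ltr_pwDl.
exists (S^-1) => [|x x0]; first by rewrite invr_gt0.
rewrite mulrC ler_pdivrMr//; set E := sum3 _ _.
have E0 : 0 <= E by do 2![apply: sumr_ge0 => ? _]; apply: sumr_ge0 => *; rewrite sqr_ge0.
have : \sum_i \sum_j (x i - x j) ^+ 2 <= (\sum_i \sum_j C i j) * E.
  rewrite mulr_suml; apply: ler_sum => i _; rewrite mulr_suml.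
  by apply: ler_sum => j _; case: (CP i j) => _ /(_ x).
have -> : \sum_i \sum_j (x i - x j) ^+ 2 = 2 * N%:R * \sum_i x i ^+ 2.
  have -> : \sum_i \sum_j (x i - x j) ^+ 2 =
      \sum_i (N%:R * x i ^+ 2 + (\sum_j x j ^+ 2) - 2 * x i * \sum_j x j).
    apply: eq_bigr => i _; rewrite mulr_sumr.
    have -> : N%:R * x i ^+ 2 = \sum_(j < N) x i ^+ 2.
      by rewrite sumr_const card_ord mulr_natl.
    by rewrite -big_split -sumrB; apply: eq_bigr => j _ /=; ring.
  rewrite x0; under eq_bigr do rewrite mulr0 subr0.
  rewrite big_split/= sumr_const card_ord -mulr_sumr -[_ *+ N]mulr_natl.
  by ring.
move=> h.
have Q0 : 0 <= \sum_i x i ^+ 2 by apply: sumr_ge0 => i _; rewrite sqr_ge0.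
have : 1 * \sum_i x i ^+ 2 <= N%:R * \sum_i x i ^+ 2.
  by rewrite ler_wpM2r// ler1n; case: connT.
rewrite /S; lra.
Qed.

(** On the segment from v to u all radii stay in [exp(-B), exp B], where the
    quadratic forms of the triangles are uniformly definite modulo constants;
    the Poincare inequality glues the triangles together. *)
Lemma lcurv_strongly_monotone (B : R) : exists2 c, 0 < c & forall u v,
  (forall i, `|u i| <= B) -> (forall i, `|v i| <= B) -> \sum_i (u i - v i) = 0 ->
  c * \sum_i (u i - v i) ^+ 2 <= \sum_i (u i - v i) * (lcurv u i - lcurv v i).
Proof.
have [c c0 cP] := poincare.
pose B' := `|B|; pose p : R := expR (- B').
have p01 : 0 < p <= 1 by rewrite expR_gt0 expR_le1 oppr_le0 normr_ge0.
have p0 : 0 < p ^+ 8 / 48 by rewrite divr_gt0// exprn_gt0// expR_gt0.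
exists (6^-1 * (p ^+ 8 / 48 * c)) => [|u v uB vB uv].
  by rewrite mulr_gt0 ?invr_gt0// mulr_gt0.
rewrite lcurv_pairing -[leLHS]mulrA ler_pM2l ?invr_gt0// -[leLHS]mulrA.
apply: le_trans (ler_wpM2l (ltW p0) (cP _ uv)) _.
rewrite -sum3Z; apply: le_sum3 => i j k t.
have [s /andP[s0 s1] E] := tri_pairing_variation u v t.
rewrite -[leRHS]opprB E opprK.
case: (tri_edges surfT t) => /(cw_bounds wPhi) e1 /(cw_bounds wPhi) e2 /(cw_bounds wPhi) e3.
have bd l : p <= expR (v l + s * (u l - v l)) <= p^-1.
  rewrite /p -expRN opprK !ler_expR -ler_norml.
  have -> : v l + s * (u l - v l) = (1 - s) * v l + s * u l by ring.
  have s1' : 0 <= 1 - s by rewrite subr_ge0.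
  apply: le_trans (ler_normD _ _) _; rewrite !normrM (ger0_norm s0) (ger0_norm s1').
  have BB : B <= B' by rewrite ler_norm.
  have : s * `|u l| <= s * B' by rewrite ler_wpM2l// (le_trans (uB l)).
  have : (1 - s) * `|v l| <= (1 - s) * B'.
    by rewrite ler_wpM2l ?subr_ge0// (le_trans (vB l)).
  lra.
apply: le_trans (dirichlet_ge e1 e2 e3 _ _ _ p01 (bd i) (bd j) (bd k)).
by rewrite ler_pM2l// -[leRHS]addrA lerDl addr_ge0 ?sqr_ge0.
Qed.

(** For a set I below a large gap, the curvatures over I sum to almost
    2 pi |I| - lim_angles / 6, which the hypothesis compares strictly with
    the total of the average curvature; finiteness of the number of sets I
    makes the difference uniform. *)
Lemma lcurv_coercive : combinatorial_condition T Phi ->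
  exists D, forall u i j, D < u i - u j -> 0 <= \sum_i u i * (lcurv u i - K0).
Proof.
move=> cond.
pose bnd I : R := - (\sum_(p in Lk T I) (pi - Phi p.1))
   + 2 * pi * (euler_char (full_subcomplex T I))%:~R.
have [|d d0 dP] := @positive_lower_bound R {set 'I_N}
    (fun I => (I != finset.set0) && (I \proper [set: 'I_N]%SET))
    (fun I => K0 * #|I|%:R - bnd I).
  move=> I /andP[I0 IT]; rewrite subr_gt0; have := cond I I0 IT.
  by rewrite -/(bnd I) /kav; congr (_ < _); field; exact: lt0r_neq0 N_gt0.
have [M M0 MP] := lcurv_bounded.
pose c := sum3 T (fun _ _ _ => 1 : R).
have c0 : 0 <= c by do 2![apply: sumr_ge0 => ? _]; apply: sumr_ge0.
have pp := pi_gt0 R.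
(* There are c ordered triangles, each losing at most e: the loss is at most
   d / 6, less than half of the margin d. *)
pose e := Num.min (pi / 2) (d / (1 + c)).
have e0 : 0 < e by rewrite lt_min !divr_gt0// ltr_pwDl.
have e1 : e <= pi / 2 by rewrite ge_min lexx.
have ec : e * c <= d.
  have : e <= d / (1 + c) by rewrite ge_min lexx orbT.
  by rewrite ler_pdivlMr ?ltr_pwDl//; lra.
have s0 : 0 < sin (e / 2) by apply: sin_gt0_pi; lra.
(* The largest ratio of radii for which the angle estimates hold, up to a factor 2. *)
pose q := sin (e / 2) ^+ 2 / 6.
have ss0 : 0 < sin (e / 2) ^+ 2 by rewrite exprn_gt0.
have ss1 : sin (e / 2) ^+ 2 <= 1 by rewrite expr_le1 ?sin_le1// ltW.
have q0 : 0 < q by rewrite divr_gt0.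
have q1 : q <= 1 by rewrite /q; lra.
have qe : 6 * q < 2 * sin (e / 2) ^+ 2 by rewrite /q; lra.
(* A gap D in u is a factor q between radii. *)
pose D := - ln q.
have D0 : 0 <= D by rewrite oppr_ge0 ln_le0.
have d20 : 0 < d / 2 by rewrite divr_gt0.
exists (N%:R * (D * (N%:R * M + d / 2)) / (d / 2)) => u i j.
rewrite ltr_pdivrMr// => uij.
have := @gap_abel_bound R N (fun l => lcurv u l - K0) u M D (d / 2) (ltW M0) D0 d20
  (lcurv_sum u) (MP u) _ i j.
move=> H; apply: le_trans (H _); first by rewrite subr_ge0 [leRHS]mulrC ltW.
move=> I I0 IT gap.
have rI a b : a \in I -> b \notin I -> expR (u a) <= q * expR (u b).
  move=> aI bI; rewrite -[q in q * _]lnK ?posrE// -expRD ler_expR.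
  by have := gap _ _ aI bI; rewrite /D; lra.
have lim := lim_angles_sum surfT Phi I; rewrite -/(bnd I) in lim.
have dI := dP I; rewrite I0 IT in dI; move: (dI isT) => {}dI.
have : sum3 T (lim_angles Phi I) - e * c <=
   sum3 T (tri_pairing Phi (ind R I) (fun l => expR (u l))).
  rewrite /c -sum3Z -sum3N -sum3D; apply: le_sum3 => a b f t; rewrite mulr1.
  exact: (tri_pairing_ge_lim surfT wPhi (expR_pos u) t e0 e1 q0 q1 qe rI).
rewrite sumrB /lcurv /curvature sumrB ind_sum// !sumr_const.
rewrite -[(2 * pi) *+ _]mulr_natr -[K0 *+ _]mulr_natr.
lra.
Qed.

End LogCurvature.

(** * Bounded Lipschitz differential equations *)

Section Comparison.
Variable R : realType.

Lemma cauchy_bound_limit (U b : nat -> R) : b n @[n --> \oo] --> 0 ->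
  (forall n m, (n <= m)%N -> `|U m - U n| <= b n) ->
  exists l, U n @[n --> \oo] --> l /\ forall n, `|U n - l| <= b n.
Proof.
move=> b0 Ub.
have cU : cvg (U n @[n --> \oo]).
  apply/cauchy_cvgP; apply: cauchy_exP => e e0.
  have [n _ nb] := cvgr0_norm_lt b b0 e e0.
  exists (U n); exists n => // m /= nm.
  rewrite /ball/= distrC; apply: le_lt_trans (Ub _ _ nm) _.
  by apply: le_lt_trans (ler_norm _) _; apply: nb => /=.
exists (lim (U n @[n --> \oo])); split=> // n.
apply/ler_addgt0Pr => e e0.
have [m _ mb] := cvgr_dist_le U _ cU e e0.
have := Ub n (maxn n m) (leq_maxl _ _); have := mb (maxn n m) (leq_maxr _ _).
move=> /= h1 h2; apply: le_trans (ler_distD (U (maxn n m)) _ _) _.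
by rewrite distrC [X in _ + X]distrC lerD.
Qed.

(** Both g - f and g + f are nondecreasing. *)
Lemma derivative_bound (f g df dg : R -> R) :
  (forall t : R, 0 <= t -> is_derive t 1 f (df t)) ->
  (forall t : R, 0 <= t -> is_derive t 1 g (dg t)) ->
  (forall t, 0 <= t -> `|df t| <= dg t) -> `|f 0| <= g 0 ->
  forall t, 0 <= t -> `|f t| <= g t.
Proof.
move=> hf hg le le0 t t0.
have H1 := @mean_value _ (fun s => g s - f s) (fun s => dg s - df s) 0 t t0
   (fun s (st : 0 <= s <= t) => derB (hg s (andP st).1) (hf s (andP st).1)).
have H2 := @mean_value _ (fun s => g s + f s) (fun s => dg s + df s) 0 t t0
   (fun s (st : 0 <= s <= t) => derD (hg s (andP st).1) (hf s (andP st).1)).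
have [c /andP[c0 _] E1] := H1; have [d /andP[d0 _] E2] := H2.
have := le c c0; have := le d d0; rewrite !ler_norml => /andP[l1 l2] /andP[l3 l4].
have p1 : 0 <= (dg c - df c) * (t - 0) by rewrite subr0 mulr_ge0// subr_ge0.
have p2 : 0 <= (dg d + df d) * (t - 0) by rewrite subr0 mulr_ge0//; lra.
by move: le0; rewrite !ler_norml => /andP[? ?]; apply/andP; split; lra.
Qed.

Lemma is_derive_expR_scale (a c t : R) :
  is_derive t 1 (fun s => c * expR (a * s)) (a * c * expR (a * t)).
Proof.
have h := @der_comp _ expR (fun s => a * s) t _ _ (is_derive_expR _) (derZ a (der_id t)).
by apply: (is_derive_eq (derZ c h)); ring.
Qed.

(** Starting the integral at -1 makes 0 an interior point, so that primitives
    have two-sided derivatives on the whole of [0, +oo[. *)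
Definition primitive (f : R -> R) (y : R) : R :=
  (\int[lebesgue_measure]_(s in `[-1, y]) f s)%R.

Lemma is_derive_primitive (f : R -> R) (y : R) : continuous f -> -1 < y ->
  is_derive y 1 (primitive f) (f y).
Proof.
move=> cf y1.
have int : lebesgue_measure.-integrable `[(-1 : R), y + 1] (EFin \o f).
  apply: continuous_compact_integrable; first exact: segment_compact.
  by apply: continuous_subspaceT => x; apply: cf.
have y2 : y < y + 1 by rewrite ltrDl.
have [d1 d2] := continuous_FTC1_closed y2 int y1 (cf y).
exact: DeriveDef d1 (etrans (esym (derive1E _ _)) d2).
Qed.

Lemma lipschitz_continuous (f : R -> R) (M : R) :
  (forall s t, `|f s - f t| <= M * `|s - t|) -> continuous f.
Proof.
move=> fM t; apply/cvgrPdist_le => e e0.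
have M0 : 0 < `|M| + 1 by rewrite ltr_wpDl.
near=> s.
apply: le_trans (fM _ _) _; apply: (@le_trans _ _ ((`|M| + 1) * `|t - s|)).
  by rewrite ler_wpM2r// (le_trans (ler_norm M))// lerDl.
rewrite mulrC -ler_pdivlMr//; near: s.
by apply: cvgr_dist_le; [exact: cvg_id|rewrite divr_gt0].
Unshelve. all: by end_near. Qed.

End Comparison.

Section GlobalFlow.
Variables (R : realType) (N : nat) (G : ('I_N -> R) -> 'I_N -> R) (L M : R).
Hypothesis G_lip : forall u v i, `|G u i - G v i| <= L * \sum_j `|u j - v j|.
Hypothesis G_bnd : forall u i, `|G u i| <= M.
Hypotheses (L0 : 0 <= L) (M0 : 0 <= M).
Variable u0 : 'I_N -> R.

Definition pos_part (t : R) := Num.max t 0.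

(** The vector field is evaluated at max(s, 0), so the iterates only depend on
    the values of u at nonnegative times. *)
Definition picard (u : R -> 'I_N -> R) (t : R) (i : 'I_N) : R :=
  let g s := G (u (pos_part s)) i in u0 i + (primitive g t - primitive g 0).

Definition comp_continuous (u : R -> 'I_N -> R) :=
  forall i t, 0 <= t -> {for t, continuous (fun s => u s i)}.

Lemma pos_part_lip s t : `|pos_part s - pos_part t| <= `|s - t|.
Proof.
rewrite /pos_part.
case: (leP s 0) => s0; case: (leP t 0) => t0; rewrite ?subrr ?normr0//.
- rewrite sub0r normrN gtr0_norm// ler0_norm ?opprB; lra.
- rewrite subr0 gtr0_norm// ger0_norm; lra.
Qed.

Lemma pos_part_continuous : continuous pos_part.
Proof.
by apply: (@lipschitz_continuous _ _ 1) => s t; rewrite mul1r pos_part_lip.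
Qed.

Lemma pos_part_ge0 t : 0 <= pos_part t.
Proof. by rewrite /pos_part le_max lexx orbT. Qed.

Lemma pos_partE t : 0 <= t -> pos_part t = t.
Proof. by move=> t0; rewrite /pos_part max_l. Qed.

Lemma field_continuous (h : R -> 'I_N -> R) i t :
  (forall j, {for t, continuous (fun s => h s j)}) ->
  {for t, continuous (fun s => G (h s) i)}.
Proof.
move=> ch; apply/cvgrPdist_le => e e0.
pose d : R := e / (L * N%:R + 1).
have LN : 0 < L * N%:R + 1 by rewrite ltr_wpDl// mulr_ge0.
have d0 : 0 < d by rewrite divr_gt0.
have H j : \forall s \near t, `|h t j - h s j| <= d.
  exact: (cvgr_dist_le (fun s => h s j) (h t j) (ch j) d d0).
have {}H := @filter_forall _ _ (fun j s => `|h t j - h s j| <= d) _ (nbhs_filter t) H.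
near=> s; apply: le_trans (G_lip _ _ _) _.
apply: (@le_trans _ _ (L * (N%:R * d))).
  rewrite ler_wpM2l//; have -> : N%:R * d = \sum_(j < N) d.
    by rewrite sumr_const card_ord mulr_natl.
  by apply: ler_sum => j _; move: (j); near: s.
rewrite /d mulrA mulrCA ger_pMr// ler_pdivrMr//; lra.
Unshelve. all: by end_near. Qed.

Lemma is_derive_picard u i (t : R) : comp_continuous u -> -1 < t ->
  is_derive t 1 (fun s => picard u s i) (G (u (pos_part t)) i).
Proof.
move=> cu t1; rewrite /picard.
have cg : continuous (fun s => G (u (pos_part s)) i).
  move=> s; apply: (@field_continuous (fun s => u (pos_part s))) => j.
  apply: (@continuous_comp _ _ _ pos_part (fun s => u s j)).
    exact: pos_part_continuous.
  exact: cu (pos_part_ge0 _).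
have := derD (derC t (u0 i)) (derB (is_derive_primitive cg t1)
  (derC t (primitive (fun s => G (u (pos_part s)) i) 0))).
by move=> h; apply: (is_derive_eq h); ring.
Qed.

Lemma picard0 u i : picard u 0 i = u0 i.
Proof. by rewrite /picard subrr addr0. Qed.

Lemma picard_continuous u : comp_continuous u -> comp_continuous (picard u).
Proof.
move=> cu i t t0; apply: der_continuous; apply: is_derive_picard => //.
by apply: lt_le_trans t0; rewrite oppr_lt0.
Qed.

Definition picard_iter n := iter n picard (fun _ => u0).

Lemma picard_iter_continuous n : comp_continuous (picard_iter n).
Proof.
elim: n => [|n IH]; last exact: picard_continuous.
by move=> i t _; apply: cvg_cst.
Qed.

(** Uniform in n, thanks to the bound on G, so that the limit inherits the
    Lipschitz constant and is continuous. *)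
Lemma picard_iter_lip n i s t : 0 <= s -> 0 <= t ->
  `|picard_iter n s i - picard_iter n t i| <= M * `|s - t|.
Proof.
case: n => [|n]; first by rewrite subrr normr0 mulr_ge0.
wlog st : s t / s <= t => [H s0 t0|s0 t0].
  by case: (leP s t) => [/H|/ltW/H] h; [exact: h|rewrite distrC [`|s - t|]distrC; exact: h].
have [x /andP[sx _] E] := mean_value st (fun x (h : s <= x <= t) =>
  is_derive_picard i (@picard_iter_continuous n)
   (lt_le_trans (ltrN10 R) (le_trans s0 (andP h).1))).
by rewrite distrC [`|s - t|]distrC E normrM ler_wpM2r.
Qed.

Let neg1 (t : R) : 0 <= t -> -1 < t.
Proof. by move=> t0; apply: lt_le_trans t0; rewrite oppr_lt0. Qed.

(** The weight exp(k t) replaces a short time interval: integrating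
    C exp(k t) divides it by k, which beats the Lipschitz constant. *)
Lemma picard_contract (u v : R -> 'I_N -> R) (C k : R) : 0 <= C -> 0 < k -> 2 * L * N%:R <= k ->
  comp_continuous u -> comp_continuous v ->
  (forall t i, 0 <= t -> `|u t i - v t i| <= C * expR (k * t)) ->
  forall t i, 0 <= t -> `|picard u t i - picard v t i| <= C / 2 * expR (k * t).
Proof.
move=> C0 k0 kL cu cv uv t i.
apply: (@derivative_bound _ (fun s => picard u s i - picard v s i)
  (fun s => C / 2 * expR (k * s))
  (fun s => G (u (pos_part s)) i - G (v (pos_part s)) i)
  (fun s => k * (C / 2) * expR (k * s))).
- by move=> s /neg1 s1; apply: derB; apply: is_derive_picard.
- by move=> s _; apply: is_derive_expR_scale.
- move=> s s0; rewrite pos_partE//; apply: le_trans (G_lip _ _ _) _.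
  apply: (@le_trans _ _ (L * \sum_(j < N) C * expR (k * s))).
    by rewrite ler_wpM2l//; apply: ler_sum => j _; apply: uv.
  rewrite sumr_const card_ord -[_ *+ N]mulr_natl.
  have : 0 <= C * expR (k * s) by rewrite mulr_ge0// expR_ge0.
  by move/(ler_wpM2r)/(_ _ _ kL); lra.
- by rewrite !picard0 subrr normr0 mulr_ge0 ?expR_ge0// divr_ge0.
Qed.

(** The iterates converge geometrically at every t >= 0.  The limit W is
    Lipschitz, hence picard W makes sense, and contraction shows that it
    agrees with W at nonnegative times. *)
Theorem global_flow : exists u : R -> 'I_N -> R, (forall i, u 0 i = u0 i) /\
  forall (t : R) i, 0 <= t -> is_derive t 1 (fun s => u s i) (G (u t) i).
Proof.
(* At least twice the l1 Lipschitz constant, and positive even if L or N is 0. *)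
pose k := 2 * L * N%:R + 1.
have k0 : 0 < k by rewrite ltr_wpDl// !mulr_ge0.
have kL : 2 * L * N%:R <= k by rewrite lerDl.
pose C := M / k; have C0 : 0 <= C by rewrite divr_ge0// ltW.
pose b n : R := C / 2 ^+ n.
have b0 n : 0 <= b n by rewrite divr_ge0// exprn_ge0.
have bS n : b n.+1 = b n / 2 by rewrite /b exprS invfM mulrA mulrAC.
have step n t i : 0 <= t ->
   `|picard_iter n.+1 t i - picard_iter n t i| <= b n * expR (k * t).
  elim: n t i => [|n IH] t i.
    apply: (@derivative_bound _ (fun s => picard_iter 1 s i - picard_iter 0 s i)
     (fun s => b 0%N * expR (k * s)) (fun s => G (picard_iter 0 (pos_part s)) i - 0)
     (fun s => k * b 0%N * expR (k * s))).
    - move=> s /neg1 s1; apply: derB; last exact: derC.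
      exact: is_derive_picard (@picard_iter_continuous 0%N) s1.
    - by move=> s _; apply: is_derive_expR_scale.
    - move=> s s0; rewrite subr0; apply: le_trans (G_bnd _ _) _.
      rewrite /b expr0 divr1 /C [k * _]mulrC divfK ?gt_eqF//.
      by rewrite ler_peMr// -expR0 ler_expR mulr_ge0// ltW.
    - by rewrite [picard_iter 1 0 i]picard0 subrr normr0 mulr_ge0 ?expR_ge0.
  move=> t0; rewrite bS.
  exact: (@picard_contract (picard_iter n.+1) (picard_iter n) (b n) k (b0 n) k0 kL
    (@picard_iter_continuous n.+1) (@picard_iter_continuous n) IH).
have cau t i n m : 0 <= t -> (n <= m)%N ->
   `|picard_iter m t i - picard_iter n t i| <= 2 * b n * expR (k * t).
  move=> t0 nm; apply: (@le_trans _ _ ((2 * b n - 2 * b m) * expR (k * t))); last first.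
    by rewrite ler_wpM2r ?expR_ge0// gerBl mulr_ge0.
  rewrite -(subnKC nm); elim: (m - n)%N => [|d IH].
    by rewrite addn0 !subrr normr0 mul0r.
  rewrite addnS bS; have := step (n + d)%N t i t0; move: IH.
  move: (picard_iter (n + d).+1 t i) (picard_iter (n + d) t i) => x y h1 h2.
  by apply: le_trans (ler_distD y _ _) _; lra.
have small c e : 0 < e -> exists n, 2 * b n * c <= e.
  move=> e0.
  have cv : geometric (2 * C * c) 2^-1 n @[n --> \oo] --> (0 : R).
    by apply: cvg_geometric; rewrite ger0_norm ?invr_ge0// invf_lt1// ltr1n.
  have [n _ nP] := cvgr0_norm_le _ cv e e0.
  exists n; apply: le_trans (nP n _); last by rewrite /= leqnn.
  apply: le_trans (ler_norm _); rewrite /geometric/= exprVn /b; lra.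
have lims t : exists l : 'I_N -> R, 0 <= t ->
    forall i n, `|picard_iter n t i - l i| <= 2 * b n * expR (k * t).
  have [t0|t0] := leP 0 t; last by exists u0.
  have H i : exists l, forall n, `|picard_iter n t i - l| <= 2 * b n * expR (k * t).
    have [|n m nm|l [_ lP]] := @cauchy_bound_limit R (fun n => picard_iter n t i)
        (fun n => 2 * b n * expR (k * t)).
    - have -> : (fun n => 2 * b n * expR (k * t)) = geometric (2 * C * expR (k * t)) 2^-1.
        by apply/funext => n; rewrite /geometric/= exprVn /b; ring.
      by apply: cvg_geometric; rewrite ger0_norm ?invr_ge0// invf_lt1// ltr1n.
    - exact: cau.
    - by exists l.
  by have [l lP] := fin_all_exists H; exists l.
have [V VP] := choice lims.
pose W t := V (pos_part t).
have W_lip i s t : `|W s i - W t i| <= M * `|s - t|.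
  apply: (@le_trans _ _ (M * `|pos_part s - pos_part t|)); last first.
    by rewrite ler_wpM2l// pos_part_lip.
  rewrite /W; move: (pos_part_ge0 s) (pos_part_ge0 t).
  move: (pos_part s) (pos_part t) => {}s {}t s0 t0.
  apply/ler_addgt0Pr => e e0.
  have [n ne] := small (expR (k * s) + expR (k * t)) e e0.
  have h1 := VP s s0 i n; have h2 := VP t t0 i n; have h3 := picard_iter_lip n i s0 t0.
  have -> : V s i - V t i = - (picard_iter n s i - V s i) + (picard_iter n t i - V t i)
     + (picard_iter n s i - picard_iter n t i) by ring.
  apply: le_trans (ler_normD _ _) _; rewrite addrC lerD//.
  by apply: le_trans (ler_normD _ _) _; rewrite normrN; lra.
have cW : comp_continuous W.
  by move=> i t _; apply: (@lipschitz_continuous _ (fun s => W s i) M).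
have PW t i : 0 <= t -> picard W t i = W t i.
  move=> t0; apply/eqP; rewrite -subr_eq0 -normr_le0; apply/ler_addgt0Pr => e e0.
  rewrite add0r; have [n ne] := small (2 * expR (k * t)) e e0.
  have h1 : `|picard W t i - picard_iter n.+1 t i| <= 2 * b n / 2 * expR (k * t).
    apply: (@picard_contract W (picard_iter n)) => //; first by rewrite mulr_ge0.
      exact: (@picard_iter_continuous n).
    by move=> s j s0; rewrite distrC /W pos_partE//; apply: VP.
  have h2 := VP t t0 i n.+1; rewrite bS in h2; rewrite {2}/W pos_partE//.
  apply: le_trans (ler_distD (picard_iter n.+1 t i) _ _) _.
  have : 0 <= b n * expR (k * t) by rewrite mulr_ge0 ?expR_ge0.
  by lra.
exists (picard W); split=> [i|t i t0]; first exact: picard0.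
have -> : picard W t = W (pos_part t).
  by rewrite pos_partE//; apply/funext => j; apply: PW.
exact: is_derive_picard (neg1 t0).
Qed.
End GlobalFlow.

(** * Differential inequalities and one-sided derivatives *)

Section RealLemmas.
Variable R : realType.

Lemma mean_value_open (f df : R -> R) (a b : R) : a < b ->
  (forall s, a <= s <= b -> is_derive s 1 f (df s)) ->
  exists2 c, a < c < b & f b - f a = df c * (b - a).
Proof.
move=> ab h; have [||c] := @MVT _ f df a b ab; last by rewrite in_itv; exists c.
  by move=> x /[!in_itv]/= /andP[? ?]; apply: h; rewrite !ltW.
apply: derivable_within_continuous => x; rewrite in_itv/= => /h.
by case.
Qed.

(** The function f(t) exp(a t) is nonincreasing. *)
Lemma gronwall (f df : R -> R) (a : R) :
  (forall t : R, 0 <= t -> is_derive t 1 f (df t)) ->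
  (forall t, 0 <= t -> df t <= - a * f t) ->
  forall t, 0 <= t -> f t <= f 0 * expR (- a * t).
Proof.
move=> hf le t t0.
have [c /andP[c0 _] E] := mean_value t0 (fun s (st : 0 <= s <= t) =>
  derM (hf s (andP st).1) (is_derive_expR_scale a 1 s)).
have : f t * (1 * expR (a * t)) - f 0 * (1 * expR (a * 0)) <= 0.
  rewrite E subr0 mulr_le0_ge0//.
  have : df c * expR (a * c) <= - a * f c * expR (a * c).
    by rewrite ler_wpM2r ?expR_ge0// le.
  by lra.
rewrite mulr0 expR0 !mul1r mulr1 subr_le0 => H.
by rewrite mulNr expRN ler_pdivlMr ?expR_gt0.
Qed.

(** Consider the last time s0 <= t at which f <= m: after it f is
    nonincreasing. *)
Lemma barrier (f df : R -> R) (m : R) :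
  (forall t : R, 0 <= t -> is_derive t 1 f (df t)) -> f 0 <= m ->
  (forall t, 0 <= t -> m < f t -> df t <= 0) -> forall t, 0 <= t -> f t <= m.
Proof.
move=> hf f0 le t t0; rewrite leNgt; apply/negP => mt.
pose S := [set s | 0 <= s <= t /\ f s <= m].
have S0 : S 0 by split; rewrite ?lexx.
have Sub : ubound S t by move=> s [/andP[]].
have hS : has_sup S by split; [exists 0|exists t].
pose s0 := sup S.
have s00 : 0 <= s0 by apply: ub_le_sup => //; exists t.
have s0t : s0 <= t by apply: ge_sup => //; exists 0.
have fs0 : f s0 <= m.
  rewrite leNgt; apply/negP => ms.
  have [e /= e0 eP] := der_continuous (hf _ s00) (open_nbhs_nbhs (conj (@open_gt _ m) ms)).
  have [s [st fs] es] := sup_adherent e0 hS.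
  have ss : s <= s0 by apply: ub_le_sup => //; exists t.
  have := eP s; rewrite /ball/= ger0_norm ?subr_ge0//.
  by rewrite ltrBlDr -ltrBlDl => /(_ es); rewrite ltNge fs.
have st : s0 < t.
  by rewrite lt_neqAle s0t andbT; apply: contraTneq mt => <-; rewrite -leNgt.
have [c /andP[sc ct] E] := mean_value_open st
  (fun s (h : s0 <= s <= t) => hf s (le_trans s00 (andP h).1)).
have c0 : 0 <= c by rewrite (le_trans s00)// ltW.
have mc : m < f c.
  rewrite ltNge; apply/negP => fc.
  have : c <= s0 by apply: ub_le_sup; [exists t|split=> //; apply/andP; split=> //; exact: ltW].
  by rewrite leNgt sc.
have : df c * (t - s0) <= 0 by rewrite mulr_le0_ge0 ?le// subr_ge0.
by rewrite -E; lra.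
Qed.

(** Explicitly, from 1 + x <= exp x. *)
Lemma expR_decay (c a e : R) : 0 <= c -> 0 < a -> 0 < e ->
  exists2 T, 0 <= T & forall t, T <= t -> c * expR (- a * t) <= e.
Proof.
move=> c0 a0 e0; exists (c / (a * e)) => [|t Tt]; first by rewrite divr_ge0// ltW// mulr_gt0.
rewrite mulNr expRN ler_pdivrMr ?expR_gt0//.
have := expR_ge1Dx (a * t).
move: Tt; rewrite ler_pdivrMr ?mulr_gt0// => ct h.
have : e * (1 + a * t) <= e * expR (a * t) by rewrite ler_pM2l.
lra.
Qed.

Lemma cvg_expR_decay (f : R -> R) (l c a : R) : 0 <= c -> 0 < a ->
  (forall t, 0 <= t -> `|f t - l| <= c * expR (- a * t)) -> f t @[t --> +oo] --> l.
Proof.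
move=> c0 a0 fl; apply/cvgrPdist_le => e e0.
have [T T0 TP] := expR_decay c0 a0 e0.
exists T; split; first exact: num_real.
move=> t Tt /=; rewrite distrC.
have Tt' := ltW Tt; exact: le_trans (fl _ (le_trans T0 Tt')) (TP _ Tt').
Qed.

Lemma expR_lip (B x y : R) : `|x| <= B -> `|y| <= B ->
  `|expR x - expR y| <= expR B * `|x - y|.
Proof.
wlog xy : x y / x <= y => [H xB yB|].
  have [h|/ltW h] := leP x y; first exact: H.
  by rewrite distrC [`|x - y|]distrC; apply: H.
move=> xB yB.
have [c /andP[xc cy] E] := mean_value xy (fun s _ => is_derive_expR s).
rewrite distrC [`|x - y|]distrC E normrM (gtr0_norm (expR_gt0 _)) ler_wpM2r// ler_expR.
by apply: le_trans cy _; apply: le_trans yB; apply: ler_norm.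
Qed.

(** Caratheodory's criterion expresses the difference quotient by a function
    that is continuous at t, and restricting a limit to J is harmless. *)
Lemma is_derive_has_derivative_in (J : set R) (f : R -> R) (t d : R) :
  is_derive t 1 f d -> has_derivative_in J f t d.
Proof.
move=> /is_derive1_caratheodory[g [gE gc gt]].
rewrite /has_derivative_in -gt.
apply/cvgrPdist_le => e e0.
have H := cvgr_dist_le _ _ gc e e0; have {}H := H (nbhs_filter t).
rewrite near_withinE /dnbhs near_withinE.
near=> s => st _; rewrite gE mulfK ?subr_eq0//.
near: s; exact: H.
Unshelve. all: by end_near. Qed.

(** Continuing f linearly to negative times turns the one-sided derivative at 0
    into a two-sided one. *)
Lemma has_derivative_in_extend (b : R) (f : R -> R) (d0 d t : R) : 0 <= t < b ->
  (t = 0 -> d = d0) -> has_derivative_in `[0, b[ f t d ->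
  is_derive t 1 (fun s => if s < 0 then f 0 + s * d0 else f s) d.
Proof.
move=> /andP[t0 tb] td H; apply/is_derive1_caratheodory.
pose F s := if s < 0 then f 0 + s * d0 else f s; rewrite -/F.
exists (fun s => if s == t then d else (F s - F t) / (s - t)); split.
- move=> z; case: eqVneq => [->|zt]; first by rewrite !subrr mulr0.
  by rewrite divfK// subr_eq0.
- apply/cvgrPdist_le => e e0 /=; rewrite eqxx.
  have := cvgr_dist_le _ _ H e e0; rewrite near_withinE /dnbhs near_withinE => Hn.
  have Hs : \forall s \near t, 0 < t -> 0 < s.
    have [tp|tp] := ltP 0 t; last exact: filterE.
    by apply: filterS (lt_nbhsr tp).
  have Hb := lt_nbhsl tb.
  near=> s; case: eqVneq => [_|st]; first by rewrite subrr normr0 ltW.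
  have [s0|s0] := ltP s 0.
    have tz : t = 0.
      apply/eqP; rewrite eq_le t0 andbT leNgt; apply/negP => tp.
      have : 0 < t -> 0 < s by near: s.
      by move=> /(_ tp) sp; have := lt_trans sp s0; rewrite ltxx.
    rewrite td// /F s0 tz ltxx subr0.
    have -> : (f 0 + s * d0 - f 0) / s = d0.
      by rewrite addrAC subrr add0r mulrAC mulfV ?mul1r// lt_eqF.
    by rewrite subrr normr0 ltW.
  rewrite /F !ltNge s0 t0 /=.
  have sb : s < b by near: s.
  have := st; move: (s0) (sb).
  suff : s != t -> s \in `[0, b[ -> `|d - (f s - f t) / (s - t)| <= e.
    by move=> h s0' sb' st'; apply: h => //; rewrite in_itv/= s0' sb'.
  near: s; exact: Hn.
- by rewrite eqxx.
Unshelve. all: by end_near. Qed.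

End RealLemmas.

(** * Long-time behaviour *)

Section LongTime.
Variables (R : realType) (N : nat) (T : {set {set 'I_N}}).
Hypothesis surfT : closed_surface_triangulation T.
Hypothesis connT : connected_complex T.
Variable Phi : {set 'I_N} -> R.
Hypothesis wPhi : is_weight T Phi.
Implicit Types (u v : R -> 'I_N -> R) (i j : 'I_N).

Local Notation K0 := (kav R T).
Local Notation lcurv := (lcurv T Phi).

Definition log_flow_at u (t : R) := forall i,
  is_derive t 1 (fun s => u s i) (- (lcurv (u t) i - K0)).

Definition log_flow u := forall t : R, 0 <= t -> log_flow_at u t.

Lemma is_derive_sqr_dist u v (t : R) : log_flow_at u t -> log_flow_at v t ->
  is_derive t 1 (fun s => \sum_i (u s i - v s i) ^+ 2)
    (- 2 * \sum_i (u t i - v t i) * (lcurv (u t) i - lcurv (v t) i)).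
Proof.
move=> hu hv.
have h := der_sum predT (fun i => derX2 (derB (hu i) (hv i))).
by apply: (is_derive_eq h); rewrite mulr_sumr; apply: eq_bigr => i _; ring.
Qed.

(** The equation is autonomous. *)
Lemma log_flow_shift u (h : R) : 0 <= h -> log_flow u -> log_flow (fun t => u (t + h)).
Proof.
move=> h0 hu t t0 i.
have th : 0 <= t + h by rewrite addr_ge0.
have d := @der_comp _ (fun s => u s i) (fun s => s + h) t _ _ (hu _ th i)
  (derD (der_id t) (derC t h)).
by apply: (is_derive_eq d); rewrite addr0 mulr1.
Qed.

Lemma log_flow_sum u t : log_flow u -> 0 <= t -> \sum_i u t i = \sum_i u 0 i.
Proof.
move=> hu t0.
have [c /andP[c0 _]] := mean_value t0 (fun s (st : 0 <= s <= t) =>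
  der_sum predT (hu s (andP st).1)).
by rewrite sumrN lcurv_sum// oppr0 mul0r => /eqP; rewrite subr_eq0 => /eqP.
Qed.

(** By monotonicity the squared distance of the solutions is nonincreasing, and
    it vanishes at time 0. *)
Lemma log_flow_unique u v (b : R) : (forall t, 0 <= t < b -> log_flow_at u t) ->
  (forall t, 0 <= t < b -> log_flow_at v t) -> (forall i, u 0 i = v 0 i) ->
  forall t i, 0 <= t < b -> u t i = v t i.
Proof.
move=> hu hv uv t i /andP[t0 tb].
have H s : 0 <= s <= t -> 0 <= s < b by move=> /andP[-> st]; exact: le_lt_trans tb.
have [c ct E] := mean_value t0 (fun s st => is_derive_sqr_dist (hu s (H s st)) (hv s (H s st))).
have D0 : \sum_i (u 0 i - v 0 i) ^+ 2 = 0.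
  by apply: big1 => j _; rewrite uv subrr expr0n.
have : \sum_i (u t i - v t i) ^+ 2 <= 0.
  rewrite D0 !subr0 in E; rewrite E.
  rewrite mulr_le0_ge0// mulNr oppr_le0 mulr_ge0//.
  exact: lcurv_monotone.
have S0 j : 0 <= (u t j - v t j) ^+ 2 by rewrite sqr_ge0.
move=> le0; have : (u t i - v t i) ^+ 2 <= 0.
  by apply: le_trans le0; rewrite (bigD1 i)//= lerDl sumr_ge0.
by rewrite expr2 => h; apply/eqP; rewrite -subr_eq0 -sqrf_eq0 eq_le sqr_ge0 andbT expr2.
Qed.

(** The time shift by h = s - t is another solution, at bounded distance, with
    the same sum of coordinates; strong monotonicity and Gronwall's inequality
    apply to the squared distance. *)
Lemma log_flow_contract u (B : R) : log_flow u -> (forall t i, 0 <= t -> `|u t i| <= B) ->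
  exists c a, [/\ 0 <= c, 0 < a & forall s t i, 0 <= t -> t <= s ->
    `|u s i - u t i| <= c * expR (- a * t)].
Proof.
move=> hu uB.
have [a a0 aP] := lcurv_strongly_monotone surfT connT wPhi B.
have B0 : 0 <= `|B| by [].
have N1 : 1 <= N%:R :> R by rewrite ler1n; case: connT.
exists (N%:R * (2 * `|B|)), a; split=> //.
move=> s t i t0 ts; pose h := s - t; have h0 : 0 <= h by rewrite subr_ge0.
have hs := log_flow_shift h0 hu.
pose D x := \sum_i (u (x + h) i - u x i) ^+ 2.
have := @gronwall R D _ (2 * a) (fun x x0 => is_derive_sqr_dist (hs x x0) (hu x x0)) _ t t0.
have -> : s = t + h by rewrite /h addrC subrK.
move=> H.
have xB x j : 0 <= x -> `|u (x + h) j - u x j| <= 2 * `|B|.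
  move=> x0; apply: le_trans (ler_normB _ _) _.
  have := uB (x + h) j (addr_ge0 x0 h0); have := uB x j x0.
  have := ler_norm B; lra.
have {}H : D t <= D 0 * expR (- (2 * a) * t).
  apply: H => x x0; rewrite mulNr mulNr lerN2 -mulrA ler_pM2l//.
  apply: aP => [j|j|]; [|exact: uB|].
  - exact: uB (addr_ge0 x0 h0).
  - by rewrite sumrB (log_flow_sum hu (addr_ge0 x0 h0)) (log_flow_sum hu x0) subrr.
have D0 : D 0 <= N%:R * (2 * `|B|) ^+ 2.
  have -> : N%:R * (2 * `|B|) ^+ 2 = \sum_(j < N) (2 * `|B|) ^+ 2.
    by rewrite sumr_const card_ord mulr_natl.
  apply: ler_sum => j _; rewrite -real_normK ?num_real//.
  by rewrite ler_pXn2r ?nnegrE ?mulr_ge0// xB.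
rewrite -(@ler_pXn2r _ 2%N)// ?nnegrE ?mulr_ge0 ?expR_ge0//.
rewrite real_normK ?num_real//.
apply: (@le_trans _ _ (D t)).
  rewrite /D (bigD1 i)//= lerDl sumr_ge0// => j _; exact: sqr_ge0.
apply: le_trans H _.
have -> : expR (- (2 * a) * t) = expR (- a * t) ^+ 2.
  by rewrite expr2 -expRD; congr expR; ring.
rewrite [leRHS]exprMn ler_wpM2r ?sqr_ge0//.
apply: le_trans D0 _; rewrite [leRHS]exprMn ler_wpM2r ?sqr_ge0//.
by rewrite expr2 ler_peMr// (le_trans _ N1).
Qed.

(** If the limit curvature differed from the average, u would keep moving at
    that speed: the mean value theorem on [t, t + 1] bounds the difference by
    a multiple of exp(- a t), for every t. *)
Lemma log_flow_limit u (B : R) : log_flow u -> (forall t i, 0 <= t -> `|u t i| <= B) ->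
  exists l c a, [/\ 0 < c, 0 < a, forall i, lcurv l i = K0 &
    forall t i, 0 <= t -> `|u t i - l i| <= c * expR (- a * t)].
Proof.
move=> hu uB; have [c [a [c0 a0 cP]]] := log_flow_contract hu uB.
have H i : exists l : R, forall t, 0 <= t -> `|u t i - l| <= 2 * c * expR (- a * t).
  have [|n m nm|l [_ lP]] := @cauchy_bound_limit R (fun n => u n%:R i)
    (fun n => c * expR (- a * n%:R)).
  - apply/cvgrPdist_le => e e0; have [S S0 SP] := expR_decay c0 a0 e0.
    near=> n; rewrite sub0r normrN ger0_norm ?mulr_ge0 ?expR_ge0//.
    by apply: SP; near: n; exact: nbhs_infty_ger.
  - by apply: cP; rewrite ?ler_nat.
  exists l => t t0.
  have tn := ltW (archi_boundP t0); set n := Num.bound t in tn.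
  have h1 := cP _ _ i t0 tn; have h2 := lP n.
  apply: le_trans (ler_distD (u n%:R i) _ _) _.
  have : c * expR (- a * n%:R) <= c * expR (- a * t).
    by rewrite ler_wpM2l// ler_expR !mulNr lerN2 ler_pM2l.
  by rewrite [X in X + _]distrC; lra.
have [l lP] := fin_all_exists H.
exists l, (2 * c + 1), a; split=> //; first by lra.
  move=> i; have [L L0 LP] := lcurv_lipschitz surfT connT wPhi.
  apply/eqP; rewrite -subr_eq0 -normr_le0; apply/ler_addgt0Pr => e e0; rewrite add0r.
  have E0 : 0 <= 2 * (2 * c) + L * (N%:R * (2 * c)).
    by rewrite addr_ge0// ?mulr_ge0// ltW.
  have [t t0 tP] := expR_decay E0 a0 e0.
  have t1 : t <= t + 1 by rewrite lerDl.
  have [x /andP[tx _] E] := mean_value t1 (fun s (st : t <= s <= t + 1) =>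
     hu s (le_trans t0 (andP st).1) i).
  have x0 := le_trans t0 tx.
  have dec s : t <= s -> expR (- a * s) <= expR (- a * t).
    by move=> ts; rewrite ler_expR !mulNr lerN2 ler_pM2l.
  have h1 : `|u (t + 1) i - u t i| <= 2 * (2 * c) * expR (- a * t).
    apply: le_trans (ler_distD (l i) _ _) _; rewrite [X in _ + X]distrC.
    have := lP i (t + 1) (le_trans t0 t1); have := lP i t t0.
    have := ler_wpM2l c0 (dec _ t1); lra.
  have h2 : `|lcurv (u x) i - lcurv l i| <= L * (N%:R * (2 * c)) * expR (- a * t).
    apply: le_trans (LP _ _ _) _; rewrite -mulrA ler_pM2l// -mulrA.
    have -> : N%:R * (2 * c * expR (- a * t)) = \sum_(j < N) (2 * c * expR (- a * t)).
      by rewrite sumr_const card_ord mulr_natl.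
    apply: ler_sum => j _; apply: le_trans (lP j x x0) _.
    by rewrite ler_wpM2l ?mulr_ge0// dec.
  have h3 := tP t (lexx _).
  have -> : lcurv l i - K0 = - (u (t + 1) i - u t i) - (lcurv (u x) i - lcurv l i).
    by rewrite E; ring.
  apply: le_trans (ler_normB _ _) _; rewrite normrN.
  by apply: le_trans h3; rewrite mulrDl lerD.
move=> t i t0; apply: le_trans (lP i t t0) _.
by rewrite ler_wpM2r ?expR_ge0// lerDl.
Unshelve. all: by end_near. Qed.

(** Exponentiating back to radii, with Lipschitz constants on the bounded range
    of u. *)
Lemma log_flow_exponential u (B : R) : log_flow u -> (forall t i, 0 <= t -> `|u t i| <= B) ->
  exists rinf : 'I_N -> R, [/\ forall i, 0 < rinf i,
    forall i, curvature T Phi rinf i = K0 &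
    exponentially_fast T Phi (fun t i => expR (u t i)) (curvature T Phi rinf) rinf].
Proof.
move=> hu uB; have [l [c [a [c0 a0 lK lP]]]] := log_flow_limit hu uB.
have [L L0 LP] := lcurv_lipschitz surfT connT wPhi.
exists (fun i => expR (l i)); split=> [i|i|]; first exact: expR_gt0.
  exact: lK.
pose B' := `|B| + c.
have BB' : `|B| <= B' by rewrite lerDl ltW.
have lB i : `|l i| <= B'.
  have h := lP 0 i (lexx _); rewrite mulr0 expR0 mulr1 in h.
  have h2 := uB 0 i (lexx _).
  have -> : l i = u 0 i - (u 0 i - l i) by ring.
  by apply: le_trans (ler_normB _ _) _; rewrite lerD// (le_trans h2)// ler_norm.
exists (L * (N%:R * c) + expR B' * c), a.
have p1 : 0 <= L * (N%:R * c) by rewrite !mulr_ge0// ltW.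
have p2 : 0 < expR B' * c by rewrite mulr_gt0// expR_gt0.
split=> //; first by rewrite ltr_wpDl.
move=> t t0 i; have e0 := expR_gt0 (- a * t); split.
  apply: (@le_trans _ _ (L * (N%:R * c) * expR (- a * t))); last first.
    by rewrite (ler_wpM2r (ltW e0))// lerDl ltW.
  apply: le_trans (LP _ _ _) _; rewrite -mulrA ler_pM2l// -mulrA.
  have -> : N%:R * (c * expR (- a * t)) = \sum_(j < N) (c * expR (- a * t)).
    by rewrite sumr_const card_ord mulr_natl.
  by apply: ler_sum => j _; exact: lP.
apply: (@le_trans _ _ (expR B' * c * expR (- a * t))); last first.
  by rewrite (ler_wpM2r (ltW e0))// lerDr.
have uB' : `|u t i| <= B'.
  by apply: le_trans (uB t i t0) _; apply: le_trans (ler_norm _) BB'.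
apply: le_trans (expR_lip uB' (lB i)) _.
by rewrite -mulrA ler_pM2l ?expR_gt0// lP.
Qed.

(** The sum of the coordinates is constant, so |u|^2 can only be large if the
    spread is; there it is nonincreasing by coercivity. *)
Lemma log_flow_bounded_of_condition u : log_flow u -> combinatorial_condition T Phi ->
  exists B, forall t i, 0 <= t -> `|u t i| <= B.
Proof.
move=> hu cond; have [D DP] := lcurv_coercive surfT connT wPhi cond.
have N0 := N_gt0 R connT.
pose sg := `|\sum_i u 0 i|; pose S := sg + `|D|.
have sg0 : 0 <= sg by exact: normr_ge0.
have S0 : 0 <= S by rewrite addr_ge0.
pose f t := \sum_i u t i ^+ 2.
pose m := Num.max (f 0) (N%:R * S ^+ 2).
have hf (t : R) : 0 <= t -> is_derive t 1 f (- 2 * \sum_i u t i * (lcurv (u t) i - K0)).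
  move=> t0; have h := der_sum predT (fun i => derX2 (hu t t0 i)).
  by apply: (is_derive_eq h); rewrite mulr_sumr; apply: eq_bigr => i _; ring.
have fm := @barrier R f _ m hf.
have N1 : 1 <= N%:R :> R by rewrite ler1n; case: connT.
have {}fm : forall t, 0 <= t -> f t <= m.
  apply: fm => [|t t0 mf]; first by rewrite le_max lexx.
  rewrite mulNr oppr_le0 mulr_ge0//.
  have [[i [j ij]]|none] := pselect (exists i j, D < u t i - u t j).
    exact: DP ij.
  (* With spread at most D, every coordinate is within |D| of the mean, whose
     absolute value is at most sg. *)
exfalso; move: mf; rewrite ltNge => /negP; apply.
  rewrite le_max; apply/orP; right.
  have -> : N%:R * S ^+ 2 = \sum_(j < N) S ^+ 2.
    by rewrite sumr_const card_ord mulr_natl.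
  apply: ler_sum => i _; rewrite -real_normK ?num_real// ler_pXn2r ?nnegrE//.
  have le j : u t i - u t j <= D by rewrite leNgt; apply/negP => ?; apply: none; exists i, j.
  have ge j : u t j - u t i <= D by rewrite leNgt; apply/negP => ?; apply: none; exists j, i.
  have E : N%:R * u t i = \sum_j u 0 j + \sum_j (u t i - u t j).
    rewrite sumrB (log_flow_sum hu)// sumr_const card_ord -[u t i *+ N]mulr_natl; ring.
  have h : `|N%:R * u t i| <= sg + N%:R * `|D|.
    rewrite E; apply: le_trans (ler_normD _ _) _; rewrite lerD2l.
    apply: le_trans (ler_norm_sum _ _ _) _.
    have -> : N%:R * `|D| = \sum_(j < N) `|D| by rewrite sumr_const card_ord mulr_natl.
    apply: ler_sum => j _; rewrite ler_norml.
    by have := le j; have := ge j; have := ler_norm D; lra.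
  rewrite normrM ger0_norm// in h.
  have : N%:R * `|u t i| <= N%:R * S.
    apply: le_trans h _; rewrite /S mulrDr lerD2r.
    by rewrite ler_peMl.
  by rewrite ler_pM2l.
exists (m + 1) => t i t0.
have h : u t i ^+ 2 <= m.
  by apply: le_trans (fm t t0); rewrite /f (bigD1 i)//= lerDl sumr_ge0// => j _; exact: sqr_ge0.
rewrite -real_normK ?num_real// in h.
have := sqr_ge0 (`|u t i| - 1); have := normr_ge0 (u t i); have := sqr_ge0 (`|u t i|); nra.
Qed.

(** Near infinity by convergence to a positive limit, and on a compact time
    interval because the velocity is bounded. *)
Lemma log_flow_bounded_of_convergent u (Kinf rinf : 'I_N -> R) : log_flow u ->
  converges_to T Phi (fun t i => expR (u t i)) Kinf rinf ->
  exists B, forall t i, 0 <= t -> `|u t i| <= B.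
Proof.
move=> hu conv.
have [M M0 MP] := lcurv_bounded surfT wPhi.
have H i : exists B : R, forall t, 0 <= t -> `|u t i| <= B.
  have [_ _ rc r0] := conv i.
  have cl : u t i @[t --> +oo] --> ln (rinf i).
    have -> : (fun t => u t i) = (fun t => ln (expR (u t i))).
      by apply/funext => t; rewrite expRK.
    exact: (@continuous_cvg _ _ _ _ _ (fun t => expR (u t i)) (@ln R) _
      (continuous_ln r0) rc).
  have [S [_ SP]] := cvgr_dist_le _ _ cl 1 ltr01.
  pose S' := `|S| + 1.
  have S'0 : 0 <= S' by rewrite addr_ge0.
  exists (`|ln (rinf i)| + 1 + `|u 0 i| + M * S') => t t0.
  have q1 : 0 <= M * S' by rewrite mulr_ge0// ltW.
  have q2 := normr_ge0 (u 0 i); have q3 := normr_ge0 (ln (rinf i)).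
  have [tS|tS] := leP t S'.
    have [x /andP[x0 _] E] := mean_value t0 (fun s (st : 0 <= s <= t) => hu s (andP st).1 i).
    have -> : u t i = u 0 i + (u t i - u 0 i) by ring.
    apply: le_trans (ler_normD _ _) _; rewrite E subr0 normrM normrN (ger0_norm t0).
    have : `|lcurv (u x) i - K0| * t <= M * S' by apply: ler_pM.
    lra.
  have : `|ln (rinf i) - u t i| <= 1.
    by apply: SP => /=; apply: le_lt_trans (ler_norm _) _; apply: lt_trans tS; rewrite ltrDl.
  move=> h; have -> : u t i = ln (rinf i) - (ln (rinf i) - u t i) by ring.
  by apply: le_trans (ler_normB _ _) _; lra.
have [B BP] := fin_all_exists H.
have B0 i : 0 <= B i by apply: le_trans (BP i 0 (lexx _)).
exists (\sum_i B i) => t i t0; apply: le_trans (BP i t t0) _.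
by rewrite (bigD1 i)//= lerDl sumr_ge0.
Qed.

End LongTime.

(** * The normalized combinatorial Ricci flow *)

(** Logarithms linearize the factor r_i of the flow.  The solution q has
    one-sided derivatives at 0, which is why it is first continued to negative
    times. *)
Lemma ricci_flow_solution_log (R : realType) (N : nat) (T : {set {set 'I_N}})
    (surfT : closed_surface_triangulation T) (Phi : {set 'I_N} -> R)
    (wPhi : is_weight T Phi) (b : R) (r0 : 'I_N -> R) (q : R -> 'I_N -> R) :
  0 < b -> ricci_flow_solution T Phi `[0, b[ r0 q ->
  exists v : R -> 'I_N -> R, (forall t, 0 <= t < b -> log_flow_at T Phi v t) /\
    forall t i, 0 <= t < b -> expR (v t i) = q t i.
Proof.
move=> b0 [q0 hq].
have J t : 0 <= t < b -> `[0, b[%classic t by rewrite /= in_itv.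
have qpos t i : 0 <= t < b -> 0 < q t i by move=> /J /hq/(_ i)[].
pose d t i := - (curvature T Phi (q t) i - average_curvature T Phi (q t)) * q t i.
pose ext t i := if t < 0 then q 0 i + t * d 0 i else q t i.
have extE t i : 0 <= t -> ext t i = q t i by move=> t0; rewrite /ext ltNge t0.
have expK t i : 0 <= t < b -> expR (ln (ext t i)) = q t i.
  by move=> tb; rewrite extE ?lnK// ?posrE ?qpos//; case/andP: tb.
exists (fun t i => ln (ext t i)); split=> // t tb i.
have [_ hd] := hq t (J t tb) i.
have qt := qpos t i tb.
have he : is_derive t 1 (fun s => ext s i) (d t i).
  by apply: has_derivative_in_extend hd => // ->.
have t0 : 0 <= t by case/andP: tb.
have pe : 0 < ext t i by rewrite extE.
have h := @der_comp _ (@ln R) (fun s => ext s i) t _ _ (is_derive1_ln pe) he.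
apply: (is_derive_eq h); rewrite extE// /d average_curvatureE//; last first.
  by move=> l; apply: qpos.
rewrite /lcurv (_ : (fun l => expR (ln (ext t l))) = q t); last first.
  by apply/funext => l; rewrite expK.
by field; rewrite gt_eqF.
Qed.

Theorem theorem1p1 (R : realType) (N : nat) (T : {set {set 'I_N}})
    (surfT : closed_surface_triangulation T) (connT : connected_complex T)
    (Phi : {set 'I_N} -> R) (wPhi : is_weight T Phi)
    (r0 : 'I_N -> R) (r0_gt0 : forall i, 0 < r0 i) :
  exists r : R -> 'I_N -> R,
    [/\ ricci_flow_solution T Phi `[0, +oo[ r0 r,
        forall (b : R) (q : R -> 'I_N -> R),
          ricci_flow_solution T Phi `[0, b[ r0 q ->
          forall t, 0 <= t < b -> forall i, q t i = r t i,
        convergent T Phi r <-> combinatorial_condition T Phi &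
        forall Kinf rinf : 'I_N -> R, converges_to T Phi r Kinf rinf ->
          exponentially_fast T Phi r Kinf rinf /\
          forall i, Kinf i = 2 * pi * (euler_char T)%:~R / N%:R /\
                    curvature T Phi rinf i
                      = 2 * pi * (euler_char T)%:~R / N%:R].
Proof.
have [L L0 Llip] := lcurv_lipschitz surfT connT wPhi.
have [M M0 Mbnd] := lcurv_bounded surfT wPhi.
pose G u i := - (lcurv T Phi u i - kav R T).
have Glip u v i : `|G u i - G v i| <= L * \sum_j `|u j - v j|.
  have -> : G u i - G v i = - (lcurv T Phi u i - lcurv T Phi v i) by rewrite /G; ring.
  by rewrite normrN.
have Gbnd u i : `|G u i| <= M by rewrite /G normrN.
have [u [u0 hu0]] := global_flow Glip Gbnd (ltW L0) (ltW M0) (fun i => ln (r0 i)).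
have hu : log_flow T Phi u by move=> t t0 i; apply: hu0.
pose r t i := expR (u t i).
have r_gt0 t i : 0 < r t i by exact: expR_gt0.
have limit_of_bounded (B : R) (uB : forall t i, 0 <= t -> `|u t i| <= B) :=
  log_flow_exponential surfT connT wPhi hu uB.
have cvg_of_exp Kinf rinf : exponentially_fast T Phi r Kinf rinf -> forall i,
    curvature T Phi (r t) i @[t --> +oo] --> Kinf i /\ r t i @[t --> +oo] --> rinf i.
  move=> [c [a [c0 a0 H]]] i.
  by split; apply: (cvg_expR_decay (ltW c0) a0) => t t0; case: (H t t0 i).
have rate Kinf rinf : converges_to T Phi r Kinf rinf ->
    exponentially_fast T Phi r Kinf rinf /\
    forall i, Kinf i = kav R T /\ curvature T Phi rinf i = kav R T.
  move=> conv; have [B uB] := log_flow_bounded_of_convergent surfT wPhi hu conv.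
  have [rinf' [_ K' E']] := limit_of_bounded B uB.
  have Er : rinf = rinf'.
    apply/funext => i; have [_ _ h _] := conv i; have [_ h'] := cvg_of_exp _ _ E' i.
    exact: cvg_unique h h'.
  have EK : Kinf = curvature T Phi rinf'.
    apply/funext => i; have [h _ _ _] := conv i; have [h' _] := cvg_of_exp _ _ E' i.
    exact: cvg_unique h h'.
  by rewrite Er EK; split=> // i; rewrite !K'.
exists r; split.
- split=> [i|t tJ i]; first by rewrite /r u0 lnK// posrE.
  have t0 : 0 <= t by move: tJ; rewrite /= in_itv/= andbT.
  split=> //; apply: is_derive_has_derivative_in.
  have h := @der_comp _ expR (fun s => u s i) t _ _ (is_derive_expR _) (hu t t0 i).
  by apply: (is_derive_eq h); rewrite average_curvatureE// mulrC.
- move=> b q hq t tb i.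
  have b0 : 0 < b by case/andP: tb; apply: le_lt_trans.
  have [v [hv vq]] := ricci_flow_solution_log surfT wPhi b0 hq.
  rewrite -vq// /r; congr expR.
  apply: (log_flow_unique surfT wPhi hv _ _ i tb) => [s /andP[s0 _]|j]; first exact: hu.
  by apply: expR_inj; rewrite vq ?lexx// u0 lnK ?posrE//; case: hq.
- split=> [[Kinf [rinf conv]]|cond].
    have [_ KE] := rate _ _ conv.
    have rinf0 l : 0 < rinf l by case: (conv l).
    move=> I I0 IT; have := thurston_inequality surfT wPhi connT rinf0 I0 IT.
    have -> : \sum_(i in I) curvature T Phi rinf i = \sum_(i in I) kav R T.
      by apply: eq_bigr => i _; case: (KE i).
    rewrite sumr_const -[_ *+ #|I|]mulr_natr.
    have -> : 2 * pi * #|I|%:R * (euler_char T)%:~R / N%:R = kav R T * #|I|%:R.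
      by rewrite /kav; field; rewrite gt_eqF// (N_gt0 R connT).
    by [].
  have [B uB] := log_flow_bounded_of_condition surfT connT wPhi hu cond.
  have [rinf [rinf0 _ E]] := limit_of_bounded B uB.
  exists (curvature T Phi rinf), rinf => i; have [h1 h2] := cvg_of_exp _ _ E i.
  split=> //; rewrite /curvature ltrBlDr ltrDl angle_sumE// mulr_gt0 ?invr_gt0//.
  have [j [k t]] := vertex_in_triangle surfT i.
  have pos a b c : tri T a b c -> 0 < inner_angle Phi rinf a b c.
    by move=> /(inner_angle_bounds surfT wPhi rinf0)/andP[].
  rewrite (bigD1 j)//= (bigD1 k)//= -addrA ltr_pwDl ?pos//.
  rewrite addr_ge0 ?sumr_ge0// => [c /andP[/pos/ltW]|c _]; first by [].
  by apply: sumr_ge0 => ? /pos/ltW.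
- exact: rate.
Qed.
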